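(* Let $\mathbf a,\mathbf a'\in\mathbb C\setminus\{0\}$ and $\mathbf b,\mathbf b'\in\mathbb R\setminus\{0\}$. For $\mathbf a\neq 0$ and $\mathbf b\in\mathbb R$ let $M(\mathbf a,\mathbf b)\subset\mathbb C^{5}$ (coordinates $z,w_1,w_2,w_3,w_4$) be the real $6$-dimensional CR-submanifold defined by $$w_1-\overline w_1=2i\,z\overline z,\qquad w_2-\overline w_2=2i\,(z^2\overline z+z\overline z^2),\qquad w_3-\overline w_3=2\,(z^2\overline z-z\overline z^2),$$ $$w_4-\overline w_4=2i\,(\mathbf a\,z^3\overline z+\overline{\mathbf a}\,z\overline z^3)+2i\,\mathbf b\,z^2\overline z^2 .$$ Then the quantity $$\mathfrak R=\frac{\mathbf a\overline{\mathbf a}}{\mathbf b^2}$$ is the single essential invariant of the biholomorphic equivalence problem for the manifolds $M(\mathbf a,\mathbf b)$ with $\mathbf b\neq 0$; that is, $M(\mathbf a,\mathbf b)$ and $M(\mathbf a',\mathbf b')$ are biholomorphically equivalent if and only if $$\frac{\mathbf a\overline{\mathbf a}}{\mathbf b^2}=\frac{\mathbf a'\overline{\mathbf a'}}{\mathbf b'^2}.$$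
   Context: Two real submanifolds $M,M'\subset\mathbb C^5$ are called biholomorphically equivalent if there is a local biholomorphism $h$ of $\mathbb C^5$ mapping $M$ to $M'$, i.e. there are points $p\in M$, $p'\in M'$, open neighbourhoods $V\ni p$, $V'\ni p'$ in $\mathbb C^5$ and a biholomorphic map $h:V\to V'$ with $h(p)=p'$ and $h(M\cap V)=M'\cap V'$. The class of the manifolds $M(\mathbf a,\mathbf b)$ is Beloshapka's class of universal CR-models of CR-dimension $1$ and codimension $4$. *)

(* Defs.v *)
From HB Require Import structures.
From mathcomp Require Import all_boot all_order all_algebra.
From mathcomp Require Import complex.
From mathcomp Require Import all_classical all_reals all_analysis.

Set Implicit Arguments.
Unset Strict Implicit.
Unset Printing Implicit Defensive.

Import Order.TTheory GRing.Theory Num.Theory.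
Import numFieldNormedType.Exports.

Local Open Scope classical_set_scope.
Local Open Scope complex_scope.
Local Open Scope ring_scope.

(* [R[i]] itself carries no canonical topology; naming it as a
   [numClosedFieldType] gives it, and ['rV_n] over it, the normed-space
   structure of an arbitrary [numFieldType]. *)
Definition Cplx (R : realType) : numClosedFieldType := R[i].

(* [differentiable] is Fréchet differentiability over the scalar field, here
   the complex numbers, so on an open set this is holomorphy. *)
Definition holomorphic_on (R : realType) (n : nat)
    (V : set 'rV[Cplx R]_n) (h : 'rV[Cplx R]_n -> 'rV[Cplx R]_n) : Prop :=
  forall x, V x -> differentiable h x.

(* Only the values of [h] on [V] matter. *)
Definition biholomorphic_map (R : realType) (n : nat)
    (V V' : set 'rV[Cplx R]_n) (h : 'rV[Cplx R]_n -> 'rV[Cplx R]_n) : Prop :=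
  [/\ set_bij V V' h,
      holomorphic_on V h
    & exists2 g : 'rV[Cplx R]_n -> 'rV[Cplx R]_n,
        holomorphic_on V' g & forall x, V x -> g (h x) = x].

Definition biholomorphically_equivalent (R : realType) (n : nat)
    (M M' : set 'rV[Cplx R]_n) : Prop :=
  exists (p p' : 'rV[Cplx R]_n) (V V' : set 'rV[Cplx R]_n)
      (h : 'rV[Cplx R]_n -> 'rV[Cplx R]_n),
    (M p /\ M' p') /\
    (open V /\ V p) /\
    (open V' /\ V' p') /\
    biholomorphic_map V V' h /\
    h p = p' /\
    h @` (M `&` V) = M' `&` V'.

Definition CRmodel (R : realType) (a : Cplx R) (b : R) :
    set 'rV[Cplx R]_5 :=
  [set p |
    let z := p 0 0 in
    let w1 := p 0 1 in
    let w2 := p 0 2 in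
    let w3 := p 0 3 in
    let w4 := p 0 4 in
    [/\ w1 - w1^* = 2 * 'i * (z * z^*),
        w2 - w2^* = 2 * 'i * (z ^+ 2 * z^* + z * z^* ^+ 2),
        w3 - w3^* = 2 * (z ^+ 2 * z^* - z * z^* ^+ 2)
      & w4 - w4^* =
          2 * 'i * (a * z ^+ 3 * z^* + a^* * z * z^* ^+ 3)
          + 2 * 'i * (b%:C : Cplx R) * z ^+ 2 * z^* ^+ 2]].

(* Main.v *)
Require Import Defs.
From HB Require Import structures.
From mathcomp Require Import all_boot all_order all_algebra.
From mathcomp Require Import complex.
From mathcomp Require Import all_classical all_reals all_analysis.
From mathcomp Require Import ring lra.

(** The complex tangent line of M(a,b) over z is spanned by a vector [horiz],
and a plane curve z(t) lifts to a horizontal curve of M(a,b): the increments of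
the w_k are the integrals of polynomial forms Q_k(z, conj z) dz.  If g is a
closed curve whose moments of order at most two vanish ([loop]), the lift of
z_0 + e g, with e real, closes up in every coordinate but w_4, which moves by
e^4 s(g), where s(g) is the integral of the quartic part of Q_4 along g
([hlift_end]).

A map h that is holomorphic near a point of M(a,b) and sends M(a,b) into
M(a',b') sends [horiz] to a complex multiple of [horiz]; call the factor the
multiplier ([tangency]).  Blow up at a point p near which the multiplier is
bounded, and let l be its value at p.  To first order in e the z-component of
h along the lift of z_0 + e g is that of h(p) plus e l g.  Its derivative is
only known to be bounded by a multiple of e, but this suffices to pass to the
limit in the integral that gives the last coordinate of the image curve, seen
from h(p): this coordinate moves by e^4 s'(l g) + o(e^4).  It also moves by
k e^4 s(g) + o(e^4), where k is a fixed derivative of h at p, because the lift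
ends at p plus a multiple of the w_4-vector.  Hence k s(g) = s'(l g) for every
loop g ([loop_identity]): this is the homomorphism of graded groups tangent to
h, as in Pansu's differentiability theorem.

Nothing beyond complex differentiability at each point of an open set is used.
In particular the bound on the multiplier does not come from Cauchy estimates
but from Baire's theorem, which yields a point of M(a,b) near which the
multiplier is bounded ([bounded_multiplier]); the initial point is abandoned
for that one.

A two-parameter family of polynomial loops turns the identity into
k b = b' |l|^4 and k a = a' l^3 (conj l).  As h has a holomorphic inverse, l is
not 0 ([multiplier_neq0]), so k is not 0 either and the two ratios agree
([ratio_of_loops]).  Conversely, if they agree, a linear map that rotates z and
(w_2, w_3) and rescales w_4 carries one model onto the other
([ratio_equivalent]). *)

Import Order.TTheory GRing.Theory Num.Theory.
Import numFieldNormedType.Exports.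

Local Open Scope complex_scope.
Local Open Scope ring_scope.

Set Implicit Arguments.
Unset Strict Implicit.
Unset Printing Implicit Defensive.

(** * Polynomial antiderivatives, the model equations and horizontal lifts *)

Section Antiderivative.
Variable F : numFieldType.
Implicit Types p q : {poly F}.

(** The constant makes the primitive vanish at -1, where the curves start. *)
Definition antideriv p : {poly F} :=
  let q := \poly_(i < (size p).+1) (p`_i.-1 / i%:R) in q - (q.[-1])%:P.

Lemma deriv_antideriv p : (antideriv p)^`() = p.
Proof.
rewrite /antideriv derivB derivC subr0; apply/polyP => i.
rewrite coef_deriv coef_poly ltnS /=.
case: ltnP => hi; last by rewrite mul0rn nth_default.
by rewrite -[LHS]mulr_natr divfK // pnatr_eq0.
Qed.

Lemma antideriv_base p : (antideriv p).[-1] = 0.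
Proof. by rewrite /antideriv hornerD hornerN hornerC subrr. Qed.

Lemma deriv0_const p (x : F) : p^`() = 0 -> p = (p.[x])%:P.
Proof.
move=> dp0; have -> : p = (p`_0)%:P.
  apply/polyP => -[|i]; rewrite coefC //=.
  have := congr1 (fun q : {poly F} => q`_i) dp0.
  rewrite coef_deriv coef0 -mulr_natr => /eqP.
  by rewrite mulf_eq0 pnatr_eq0 orbF => /eqP.
by rewrite hornerC.
Qed.

Lemma antideriv_eq p q : q^`() = p -> antideriv p = q - (q.[-1])%:P.
Proof.
move=> dq; have h : (antideriv p - q)^`() = 0 by rewrite derivB deriv_antideriv dq subrr.
have := deriv0_const (-1) h.
rewrite hornerD antideriv_base add0r hornerN => /eqP.
by rewrite subr_eq => /eqP ->; rewrite polyCN addrC.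
Qed.

Lemma antiderivD p q : antideriv (p + q) = antideriv p + antideriv q.
Proof.
have h : (antideriv p + antideriv q)^`() = p + q by rewrite derivD !deriv_antideriv.
by rewrite (antideriv_eq h) hornerD !antideriv_base addr0 subr0.
Qed.

Lemma antiderivM (a : F) p : antideriv (a%:P * p) = a%:P * antideriv p.
Proof.
have h : (a%:P * antideriv p)^`() = a%:P * p.
  by rewrite derivM derivC mul0r add0r deriv_antideriv.
by rewrite (antideriv_eq h) hornerM antideriv_base mulr0 subr0.
Qed.

(** The integral over [-1, 1]. *)
Definition intp p : F := (antideriv p).[1].

Lemma intpD p q : intp (p + q) = intp p + intp q.
Proof. by rewrite /intp antiderivD hornerD. Qed.
Lemma intpM (a : F) p : intp (a%:P * p) = a * intp p.
Proof. by rewrite /intp antiderivM hornerM hornerC. Qed.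
Lemma intp_deriv p : intp p^`() = p.[1] - p.[-1].
Proof. by rewrite /intp (@antideriv_eq _ p erefl) // hornerD hornerN hornerC. Qed.

End Antiderivative.

Lemma ord4P (k : 'I_4) : [\/ k = 0, k = 1, k = 2 | k = 3].
Proof.
case: k => -[|[|[|[|//]]]] hk; [constructor 1|constructor 2|constructor 3|constructor 4];
  exact/val_inj.
Qed.

Section Model.
Variable R : realType.
Local Notation C := (Cplx R).

(** The coefficients of one equation of the model, namely w - conj w = 2i P
with P = c |z|^2 + 2 Re (al z^2 conj z) + 2 Re (a z^3 conj z) + b |z|^4. The
four equations have this shape, so that each fact about them is proved once. *)
Record form := Form { fc : C; fal : C; fa : C; fb : C }.

(** The second variable y stands for conj z. *)
Definition hform (f : form) (z y : C) : C :=
  fc f * z * y + fal f * z ^+ 2 * y + (fal f)^* * z * y ^+ 2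
  + fa f * z ^+ 3 * y + (fa f)^* * z * y ^+ 3 + fb f * z ^+ 2 * y ^+ 2.

(** 2i times the derivative of hform in z: along a complex tangent vector of
the model, dw = contact dz. *)
Definition contact (f : form) (z y : C) : C :=
  2 * 'i * (fc f * y + 2 * fal f * z * y + (fal f)^* * y ^+ 2
  + 3 * fa f * z ^+ 2 * y + (fa f)^* * y ^+ 3 + 2 * fb f * z * y ^+ 2).

(** Along a curve z and conj z are two polynomials in the real parameter. *)
Definition contactp (f : form) (z y : {poly C}) : {poly C} :=
  (2 * 'i)%:P * ((fc f)%:P * y + (2 * fal f)%:P * z * y + ((fal f)^*)%:P * y ^+ 2
  + (3 * fa f)%:P * z ^+ 2 * y + ((fa f)^*)%:P * y ^+ 3 + (2 * fb f)%:P * z * y ^+ 2).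
Definition hformp (f : form) (z y : {poly C}) : {poly C} :=
  (fc f)%:P * z * y + (fal f)%:P * z ^+ 2 * y + ((fal f)^*)%:P * z * y ^+ 2
  + (fa f)%:P * z ^+ 3 * y + ((fa f)^*)%:P * z * y ^+ 3 + (fb f)%:P * z ^+ 2 * y ^+ 2.

(** At real points this is the conjugate of the polynomial function. *)
Definition conjp (p : {poly C}) : {poly C} := map_poly Num.conj p.

Lemma horner_contactp f p q (t : C) : (contactp f p q).[t] = contact f p.[t] q.[t].
Proof. by rewrite /contactp /contact !hornerE. Qed.
Lemma horner_hformp f p q (t : C) : (hformp f p q).[t] = hform f p.[t] q.[t].
Proof. by rewrite /hformp /hform !hornerE. Qed.

Lemma conj_real (x : R) : (x%:C : C)^* = x%:C.
Proof. by apply/CrealP; rewrite complex_real. Qed.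

Lemma horner_conjp p (t : R) : (conjp p).[t%:C] = (p.[t%:C])^*.
Proof. by rewrite -{1}(conj_real t) /conjp horner_map. Qed.

Lemma conjpM p q : conjp (p * q) = conjp p * conjp q. Proof. exact: rmorphM. Qed.
Lemma conjpD p q : conjp (p + q) = conjp p + conjp q. Proof. exact: rmorphD. Qed.
Lemma conjpX p n : conjp (p ^+ n) = conjp p ^+ n. Proof. exact: rmorphXn. Qed.
Lemma conjpC (c : C) : conjp c%:P = (c^*)%:P. Proof. exact: map_polyC. Qed.
Lemma conjp_deriv p : conjp p^`() = (conjp p)^`(). Proof. by rewrite /conjp deriv_map. Qed.
Lemma conjpK p : conjp (conjp p) = p.
Proof. by apply/polyP => i; rewrite !coef_map /= conjCK. Qed.

Definition formReal f := (fc f)^* = fc f /\ (fb f)^* = fb f.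

(** With al = -i the cubic terms become those of the third equation. *)
Definition eqn_form (a : C) (b : R) (k : 'I_4) : form :=
  match val k with
  | 0%N => Form 1 0 0 0 | 1%N => Form 0 1 0 0 | 2%N => Form 0 (- 'i) 0 0
  | _ => Form 0 0 a (b%:C) end.

Lemma eqn_form_real a b k : formReal (eqn_form a b k).
Proof.
case: k => -[|[|[|[|k]]]] hk //; rewrite /formReal /= ?rmorph0 ?rmorph1 //.
by rewrite conj_real.
Qed.

(** Coordinate 0 is z; the w_k are the other four. *)
Definition wcoord (k : 'I_4) : 'I_5 := lift ord0 k.
Definition point_of (z : C) (w : 'I_4 -> C) : 'rV[C]_5 :=
  \row_j (if unlift ord0 j is Some k then w k else z).
Lemma point_of0 z w : point_of z w 0 0 = z. Proof. by rewrite mxE unlift_none. Qed.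
Lemma point_of_w z w k : point_of z w 0 (wcoord k) = w k. Proof. by rewrite mxE liftK. Qed.
Lemma pointP (p q : 'rV[C]_5) : p 0 0 = q 0 0 ->
  (forall k, p 0 (wcoord k) = q 0 (wcoord k)) -> p = q.
Proof. by move=> h0 h; apply/rowP => j; case: (unliftP ord0 j) => [k|] ->. Qed.

Lemma CRmodelP (a : C) (b : R) (q : 'rV[C]_5) :
  CRmodel a b q <->
  forall k, q 0 (wcoord k) - (q 0 (wcoord k))^* = 2 * 'i * hform (eqn_form a b k) (q 0 0) (q 0
    0)^*.
Proof.
have i2 : 'i * 'i = -1 :> C by rewrite -expr2 sqrCi.
have e1 : wcoord 0 = 1 :> 'I_5 by apply/val_inj.
have e2 : wcoord 1 = 2 :> 'I_5 by apply/val_inj.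
have e3 : wcoord 2 = 3 :> 'I_5 by apply/val_inj.
have ew3 : wcoord 3 = 4 :> 'I_5 by apply/val_inj.
have m2 : 2 = 2 * (- ('i * 'i)) :> C by rewrite i2 opprK mulr1.
have conjNi : (- 'i)^* = 'i :> C by rewrite rmorphN /= conjCi opprK.
split.
- move=> [h1 h2 h3 h4] k.
  case: (ord4P k) => ->.
  + by rewrite e1 h1 /hform /= rmorph0; ring.
  + by rewrite e2 h2 /hform /= rmorph1 rmorph0; ring.
  + rewrite e3 h3 /hform /= conjNi rmorph0 {1}m2; ring.
  + by rewrite ew3 h4 /hform /= rmorph0; ring.
- move=> h; split.
  + by rewrite -e1 h /hform /= rmorph0; ring.
  + by rewrite -e2 h /hform /= rmorph1 rmorph0; ring.
  + rewrite -e3 h /hform /= conjNi rmorph0 [X in _ = X * _]m2; ring.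
  + by rewrite -ew3 h /hform /= rmorph0; ring.
Qed.

(** The generator of the complex tangent line of the model over z whose
z-component is 1. *)
Definition horiz a b (z : C) : 'rV[C]_5 := point_of 1 (fun k => contact (eqn_form a b k) z z^*).

Definition liftz (p : 'rV[C]_5) (g : {poly C}) : {poly C} := g + (p 0 0)%:P.
Definition liftw a b (p : 'rV[C]_5) (g : {poly C}) (k : 'I_4) : {poly C} :=
  (p 0 (wcoord k))%:P + antideriv (contactp (eqn_form a b k) (liftz p g) (conjp (liftz p g)) *
    g^`()).

(** The horizontal lift of the plane curve p_z + g, which starts at p when g
vanishes at -1. The parameter is complex so that holomorphic maps can be
differentiated along the curve, but only at real t does the curve lie in the
model and have dhlift in the direction of horiz. *)
Definition hlift a b (p : 'rV[C]_5) (g : {poly C}) (t : C) : 'rV[C]_5 :=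
  point_of (liftz p g).[t] (fun k => (liftw a b p g k).[t]).
Definition dhlift a b (p : 'rV[C]_5) (g : {poly C}) (t : C) : 'rV[C]_5 :=
  point_of (liftz p g)^`().[t] (fun k => (liftw a b p g k)^`().[t]).

Lemma hlift_start a b p g : g.[-1] = 0 -> hlift a b p g (-1) = p.
Proof.
move=> g0; apply: pointP; rewrite /hlift.
  by rewrite point_of0 /liftz hornerD g0 hornerC add0r.
by move=> k; rewrite point_of_w hornerD hornerC antideriv_base addr0.
Qed.

Lemma dhliftE a b p g (t : R) :
  dhlift a b p g t%:C = g^`().[t%:C] *: horiz a b (hlift a b p g t%:C 0 0).
Proof.
apply: pointP; rewrite /dhlift /hlift /horiz.
  by rewrite [in RHS]mxE !point_of0 derivD derivC addr0 mulr1.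
move=> k; rewrite [in RHS]mxE !point_of_w !point_of0 derivD derivC add0r deriv_antideriv hornerM
  horner_contactp mulrC.
by rewrite horner_conjp.
Qed.

(** Because hform is real, contactp is its derivative in z and the conjugate
of contactp is minus its derivative in conj z. *)
Lemma contactp_hformp f z : formReal f ->
  contactp f z (conjp z) * z^`() - conjp (contactp f z (conjp z)) * (conjp z)^`()
   - (2 * 'i)%:P * (hformp f z (conjp z))^`() = 0.
Proof.
move=> [cr br].
have c2i : (2 * 'i)^* = - (2 * 'i) :> C by rewrite rmorphM /= conjCi rmorph_nat mulrN.
have cn (n : nat) (x : C) : (n%:R * x)^* = n%:R * x^* by rewrite rmorphM /= rmorph_nat.
rewrite /contactp !(conjpM, conjpD, conjpC, conjpX) conjpK c2i !cn !conjCK cr br.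
rewrite /hformp; move: (conjp z) => y.
rewrite !(derivD, derivM, derivC, deriv_exp, derivX).
rewrite !(polyCM, polyCN, polyCD, polyC_natr).
ring.
Qed.

(** Each equation of the model holds at the initial point, and the derivative
of the difference of its two sides along the curve is 0. *)
Lemma hlift_in a b p g (t : R) : g.[-1] = 0 -> CRmodel a b p ->
  CRmodel a b (hlift a b p g t%:C).
Proof.
move=> g0 /CRmodelP Mp; apply/CRmodelP => k; rewrite /hlift point_of0 point_of_w.
have i1 : (-1 : C) = (-1)%:C by rewrite rmorphN1.
have [cr br] := eqn_form_real a b k.
set f := eqn_form a b k in cr br *; set z := liftz p g; set w := liftw a b p g k.
have zb : z.[-1] = p 0 0 by rewrite /z hornerD g0 hornerC add0r.
have wb : w.[-1] = p 0 (wcoord k) by rewrite /w /liftw hornerD hornerC antideriv_base addr0.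
have dz : g^`() = z^`() by rewrite /z /liftz derivD derivC addr0.
have dw : w^`() = contactp f z (conjp z) * z^`().
  by rewrite /w derivD derivC add0r deriv_antideriv -dz.
clearbody z w.
pose D := w - conjp w - (2 * 'i)%:P * hformp f z (conjp z).
have dD : D^`() = 0.
  rewrite /D !derivB -conjp_deriv dw conjpM conjp_deriv derivM derivC mul0r add0r.
  exact: contactp_hformp.
have := deriv0_const (-1) dD.
have -> : D.[-1] = 0.
  rewrite /D !(horner_hformp, hornerD, hornerN, hornerM, hornerC) i1 !horner_conjp -i1.
  by rewrite zb wb Mp subrr.
move=> /(congr1 (fun q : {poly C} => q.[t%:C])).
rewrite /D !(horner_hformp, hornerD, hornerN, hornerM, hornerC) !horner_conjp => /eqP.
by rewrite subr_eq0 => /eqP.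
Qed.

End Model.

(** * Complex derivatives along the real line *)

Section NearDerivative.
Local Open Scope classical_set_scope.

(** This form makes it possible to compare derivatives over the complex
numbers with derivatives over the reals. *)
Lemma is_derive_nearP (K : numFieldType) (W : normedModType K) (f : K -> W) (a : K) (d : W) :
  is_derive a 1 f d <->
  forall e : K, 0 < e -> \forall h \near (0 : K), `|f (a + h) - f a - h *: d| <= e * `|h|.
Proof.
split=> [[df dv] e e0|fd].
- have : (fun h => h^-1 *: ((f \o shift a) (h *: 1) - f a)) @ 0^' --> d by rewrite -dv.
  move=> /cvgrPdist_le/(_ _ e0); rewrite near_withinE; apply: filterS => h.
  have [->|h0] := eqVneq h 0.
    by move=> _; rewrite !(addr0, subrr, scale0r, normr0, mulr0).
  move=> /(_ isT) /=; rewrite [h *: 1]mulr1 [h + a]addrC => le.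
  have -> : f (a + h) - f a - h *: d = - (h *: (d - h^-1 *: (f (a + h) - f a))).
    by rewrite scalerBr scalerA divff // scale1r opprB.
  by rewrite normrN normrZ mulrC ler_wpM2r.
- have c : (fun h => h^-1 *: ((f \o shift a) (h *: 1) - f a)) @ 0^' --> d.
    apply/cvgrPdist_le => e e0; rewrite near_withinE.
    have := fd _ e0; apply: filterS => h le h0 /=.
    rewrite [h *: 1]mulr1 [h + a]addrC.
    have -> : d - h^-1 *: (f (a + h) - f a) = - (h^-1 *: (f (a + h) - f a - h *: d)).
      by rewrite [in RHS]scalerBr scalerA mulVf // scale1r opprB.
    rewrite normrN normrZ normrV ?unitfE //.
    by rewrite ler_pdivrMl ?normr_gt0 // mulrC.
  split; first by apply/cvg_ex; exists d.
  exact/cvg_lim.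
Qed.

Lemma coord_le (K : numFieldType) n (v : 'rV[K]_n) j : `|v 0 j| <= `|v|.
Proof.
rewrite [leRHS]/Num.Def.normr /= mx_normE -[leLHS]nngE num_le.
exact: (le_bigmax _ _ (0, j)).
Qed.

Lemma rV_norm_le (K : numFieldType) n (v : 'rV[K]_n) (M : K) :
  0 <= M -> (forall j, `|v 0 j| <= M) -> `|v| <= M.
Proof.
move=> M0 vM; rewrite [leLHS]/Num.Def.normr /=.
have [->//|/mx_norm_neq0[[i j] /= ->]] := eqVneq (mx_norm v) 0.
by rewrite ord1.
Qed.

Lemma is_derive_row (K : numFieldType) n (c : K -> 'rV[K]_n) (d : 'rV[K]_n) (a : K) :
  (forall j, is_derive a 1 (fun t => c t 0 j) (d 0 j)) -> is_derive a 1 c d.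
Proof.
move=> h; apply/is_derive_nearP => e e0.
have : \forall x \near (0 : K), forall j, `|c (a + x) 0 j - c a 0 j - x *: d 0 j| <= e * `|x|.
  apply: (@filter_forall K _ (fun j (x : K) => `|c (a + x) 0 j - c a 0 j - x *: d 0 j| <= e *
    `|x|) (nbhs (0:K)) _) => j.
  have /is_derive_nearP := h j; exact.
apply: filterS => x hx; apply: rV_norm_le => [|j]; first by rewrite mulr_ge0 // ltW.
by rewrite !mxE; apply: hx.
Qed.

Lemma is_derive_diff_comp (K : numFieldType) (U V : normedModType K) (c : K -> U)
    (h : U -> V) (a : K) (d : U) :
  is_derive a 1 c d -> differentiable h (c a) -> is_derive a 1 (h \o c) ('d h (c a) d).
Proof.
move=> [dc cd] dh.
have dc' : differentiable c a by apply/derivable1_diffP.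
have dhc := differentiable_comp dc' dh.
apply: DeriveDef; first exact: diff_derivable.
by rewrite deriveE // diff_comp //= -cd deriveE.
Qed.

Lemma is_derive_coord (K : numFieldType) n (c : K -> 'rV[K]_n) (d : 'rV[K]_n) (a : K) j :
  is_derive a 1 c d -> is_derive a 1 (fun t => c t 0 j) (d 0 j).
Proof.
move=> /is_derive_nearP h; apply/is_derive_nearP => e e0.
move: (h e e0); apply: filterS => x; apply: le_trans.
by apply: le_trans (coord_le _ j); rewrite !mxE.
Qed.

Lemma is_derive_horner (K : numFieldType) (p : {poly K}) (a : K) :
  is_derive a 1 (horner p) p^`().[a].
Proof.
elim/poly_ind: p => [|p c ih].
  rewrite deriv0 horner0 (_ : horner 0 = cst 0); first exact: is_derive_cst.
  by apply/funext => y /=; rewrite horner0.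
rewrite (_ : horner _ = horner p * id + cst c); last first.
  by apply/funext => y /=; rewrite !hornerE.
apply: is_derive_eq.
rewrite addr0 derivD derivM derivX derivC !hornerE /GRing.scale /=; ring.
Qed.

End NearDerivative.

Section ComplexDerivative.
Local Open Scope classical_set_scope.
Variable R : realType.
Local Notation C := (Cplx R).

Lemma gt0_realC (e : C) : 0 < e -> exists2 r : R, 0 < r & e = r%:C.
Proof. by case: e => r i; rewrite ltcE /= => /andP[/eqP -> r0]; exists r. Qed.

Lemma near0_realP (P : C -> Prop) : (\forall h \near (0 : C), P h) <->
  exists2 d : R, 0 < d & forall h : C, `|h| < d%:C -> P h.
Proof.
split.
  move=> /nbhs_ballP[d /= /gt0_realC[r r0 ->]] h; exists r => // x xr; apply: h.
  by rewrite -ball_normE /= sub0r normrN.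
move=> [d d0 h]; apply/nbhs_ballP; exists d%:C => /=; first by rewrite ltcR.
by move=> x; rewrite -ball_normE /= sub0r normrN => /h.
Qed.

(** Schwarz reflection about the real axis. *)
Lemma is_derive_conj (f : C -> C) (d : C) (t : R) :
  is_derive (t%:C : C) 1 f d -> is_derive (t%:C : C) 1 (fun x => (f x^*)^*) d^*.
Proof.
move=> /is_derive_nearP h; apply/is_derive_nearP => e e0.
have /near0_realP[r r0 hr] := h e e0; apply/near0_realP; exists r => // x xr.
rewrite -[`|x|]norm_conjC -[leLHS]norm_conjC !rmorphB /= !conjCK rmorphM /= conjCK.
by rewrite rmorphD /= conj_real; apply: hr; rewrite norm_conjC.
Qed.

(** A complex derivative at a real point can be computed along the real axis. *)
Lemma derive0_real (f : C -> C) (d : C) (t r : R) : 0 < r ->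
  is_derive (t%:C : C) 1 f d ->
  (forall s : R, `|s| < r -> f (t + s)%:C = 0) -> d = 0.
Proof.
move=> r0 /is_derive_nearP h f0; apply/eqP; apply: contraT => dn0.
have dn : 0 < `|d| / 2 by rewrite divr_gt0 ?normr_gt0 ?ltr0n.
have /near0_realP[q q0 hq] := h _ dn.
pose s := Num.min r q / 2.
have m0 : 0 < Num.min r q by rewrite lt_min r0.
have s0 : 0 < s by rewrite divr_gt0.
have sm : s < Num.min r q by rewrite /s ltr_pdivrMr // ltr_pMr // ltr1n.
have ns : `|s%:C : C| = s%:C by rewrite ger0_norm // lecR ltW.
have := hq s%:C; rewrite ns ltcR => /(_ _)/wrap[].
  by apply: lt_le_trans sm _; rewrite ge_min lexx orbT.
rewrite -rmorphD f0; last first.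
  by rewrite gtr0_norm //; apply: lt_le_trans sm _; rewrite ge_min lexx.
have := f0 0; rewrite normr0 addr0 => -> //.
rewrite subrr sub0r normrN normrM ns [leRHS]mulrC ler_pM2l ?ltcR //.
by rewrite ler_pdivlMr ?ltr0n // ger_pMr ?normr_gt0 // lern1.
Qed.

Lemma is_derive_Re (f : C -> C) (d : C) (t : R) :
  is_derive (t%:C : C) 1 f d -> is_derive t 1 (fun s : R => complex.Re (f s%:C)) (complex.Re d).
Proof.
move=> /is_derive_nearP h; apply/is_derive_nearP => e e0.
have /near0_realP[q q0 hq] := h e%:C ltac:(by rewrite ltcR).
apply/nbhs_ballP; exists q => //= s; rewrite -ball_normE /= sub0r normrN => sq.
have ns : `|s%:C : C| = `|s|%:C by rewrite normc_def /= expr0n addr0 sqrtr_sqr.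
have := hq s%:C; rewrite ns ltcR => /(_ sq).
rewrite -rmorphM -lecR; apply: le_trans; rewrite -rmorphD.
apply: le_trans (normc_ge_Re _); rewrite lecR.
rewrite le_eqVlt; apply/orP; left; apply/eqP; congr `|_|.
by rewrite /= !raddfB /=; congr (_ - _); case: (d) => x y /=; rewrite mul0r subr0.
Qed.

Lemma mean_value_ineq_Re (f df : C -> C) (M : R) (t : R) : -1 <= t -> t <= 1 ->
  (forall s : R, -1 <= s <= 1 -> is_derive (s%:C : C) 1 f (df s%:C)) ->
  (forall s : R, -1 <= s <= 1 -> `|df s%:C| <= M%:C) ->
  `|complex.Re (f t%:C - f (-1))| <= 2 * M.
Proof.
move=> t1 t2 hf hM.
have M0 : 0 <= M.
  by rewrite -lecR; apply: le_trans (normr_ge0 _) (hM t _); rewrite t1.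
have [<-|/negP tn] := eqVneq (-1) t.
  by rewrite rmorphN1 subrr raddf0 normr0 mulr_ge0.
have tlt : -1 < t by rewrite lt_neqAle t1 andbT; apply/negP.
pose g s : R := complex.Re (f s%:C).
have dg (s : R) : -1 <= s <= 1 -> is_derive s 1 g (complex.Re (df s%:C)).
  by move=> hs; apply: is_derive_Re; apply: hf.
have [| |s] := @MVT _ g (fun s => complex.Re (df s%:C)) _ _ tlt.
- move=> s; rewrite in_itv /= => /andP[s1 s2]; apply: dg.
  by rewrite ltW //= (le_trans (ltW s2)).
- apply: derivable_within_continuous => s; rewrite in_itv /= => /andP[s1 s2].
  by have [|] := dg s _; rewrite ?s1 ?(le_trans s2).
rewrite in_itv /= => /andP[s1 s2] e.
have -> : complex.Re (f t%:C - f (-1)) = g t - g (-1) by rewrite /g rmorphN1 raddfB.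
rewrite e normrM.
rewrite mulrC ler_pM //.
  by rewrite ger0_norm ?subr_ge0 // opprK -lerBrDr (le_trans t2) //; lra.
rewrite -lecR; apply: le_trans (normc_ge_Re _) (hM s _).
by rewrite ltW //= (le_trans (ltW s2)).
Qed.

Lemma norm_le_ReIm (z : C) (M : R) : `|complex.Re z| <= M -> `|complex.Re ('i * z)| <= M ->
  `|z| <= (2 * M)%:C.
Proof.
have -> : 'i = 'i%C :> C by rewrite complexiE.
case: z => x y /=; rewrite mul0r mul1r sub0r normrN => hx hy.
rewrite (complexE (x +i* y)) /=; apply: le_trans (ler_normD _ _) _.
have n (s : R) : `|s%:C : C| = `|s|%:C by rewrite normc_def /= expr0n addr0 sqrtr_sqr.
rewrite normrM n n.
have -> : `|'i%C : C| = 1 by rewrite normc_def /= expr0n add0r expr1n sqrtr1.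
by rewrite mul1r -rmorphD lecR mulr_natl mulr2n lerD.
Qed.

(** The interval has length 2, and passing from the real and imaginary parts
to the modulus costs another factor 2. *)
Lemma mean_value_ineq (f df : C -> C) (M : R) (t : R) : -1 <= t <= 1 ->
  (forall s : R, -1 <= s <= 1 -> is_derive (s%:C : C) 1 f (df s%:C)) ->
  (forall s : R, -1 <= s <= 1 -> `|df s%:C| <= M%:C) ->
  `|f t%:C - f (-1)| <= (4 * M)%:C.
Proof.
move=> /andP[t1 t2] hf hM; have -> : 4 * M = 2 * (2 * M) by ring.
apply: norm_le_ReIm; first exact: mean_value_ineq_Re hf hM.
rewrite mulrBr; pose g x := 'i * f x; rewrite -/(g _) -/(g (-1)).
apply: (@mean_value_ineq_Re g (fun x => 'i * df x)) => // s hs.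
- have := hf s hs => ?; rewrite /g.
  have -> : (fun x => 'i * f x) = ('i : C) *: f by [].
  exact: is_deriveZ.
- by rewrite normrM normCi mul1r; apply: hM.
Qed.

End ComplexDerivative.

(** * The differential preserves the contact directions *)

Section DerivativeRules.
Variable R : realType.
Local Notation K := (Cplx R).
Variable a : K.

Lemma is_derive_fun_cst (c : K) : is_derive a 1 (fun _ => c) 0.
Proof. exact: is_derive_cst. Qed.
Lemma is_derive_fun_add (f g : K -> K) (df dg : K) :
  is_derive a 1 f df -> is_derive a 1 g dg -> is_derive a 1 (fun x => f x + g x) (df + dg).
Proof. by move=> hf hg; exact: (is_deriveD hf hg). Qed.
Lemma is_derive_fun_sub (f g : K -> K) (df dg : K) :
  is_derive a 1 f df -> is_derive a 1 g dg -> is_derive a 1 (fun x => f x - g x) (df - dg).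
Proof. by move=> hf hg; exact: (is_deriveB hf hg). Qed.
Lemma is_derive_fun_mul (f g : K -> K) (df dg : K) :
  is_derive a 1 f df -> is_derive a 1 g dg ->
  is_derive a 1 (fun x => f x * g x) (df * g a + f a * dg).
Proof.
by move=> hf hg; apply: is_derive_eq (is_deriveM hf hg) _; rewrite /GRing.scale /=; ring.
Qed.
Lemma is_derive_fun_exp (f : K -> K) (df : K) n :
  is_derive a 1 f df -> is_derive a 1 (fun x => f x ^+ n) (n%:R * f a ^+ n.-1 * df).
Proof.
move=> hf; rewrite (_ : (fun x => _) = f ^+ n); last by apply/funext => x; rewrite fctE.
by apply: is_derive_eq.
Qed.
End DerivativeRules.

Ltac derive_tac := lazymatch goal with
  | |- is_derive _ _ (fun v => @?F v - @?G v) _ => notypeclasses refine (@is_derive_fun_sub _ _ F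
    G _ _ _ _); derive_tac
  | |- is_derive _ _ (fun v => @?F v + @?G v) _ => notypeclasses refine (@is_derive_fun_add _ _ F
    G _ _ _ _); derive_tac
  | |- is_derive _ _ (fun v => @?F v * @?G v) _ => notypeclasses refine (@is_derive_fun_mul _ _ F
    G _ _ _ _); derive_tac
  | |- is_derive _ _ (fun v => (@?F v) ^+ _) _ => notypeclasses refine (@is_derive_fun_exp _ _ F
    _ _ _); derive_tac
  | |- is_derive _ _ (fun v => ?c) _ => first [exact: is_derive_fun_cst | eassumption]
  | |- _ => eassumption
  end.

Section Tangency.
Local Open Scope classical_set_scope.
Variable R : realType.
Local Notation C := (Cplx R).

Lemma is_derive_hform f (Z Y : C -> C) z y t : formReal f ->
  is_derive (t : C) 1 Z z -> is_derive (t : C) 1 Y y -> (Z t)^* = Y t -> z^* = y ->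
  is_derive (t : C) 1 (fun x => 2 * 'i * hform f (Z x) (Y x))
     (contact f (Z t) (Y t) * z - (contact f (Z t) (Y t) * z)^* ).
Proof.
move=> [cr br] dZ dY ZY zy.
have c2i : (2 * 'i)^* = - (2 * 'i) :> C by rewrite rmorphM /= conjCi rmorph_nat mulrN.
have cn (n : nat) (x : C) : (n%:R * x)^* = n%:R * x^* by rewrite rmorphM /= rmorph_nat.
rewrite /hform.
eapply is_derive_eq; first by derive_tac.
rewrite /contact !(rmorph_nat, rmorphM, rmorphD, rmorphXn) /= -ZY -zy !conjCK cr br conjCi.
ring.
Qed.

Lemma is_derive_hlift a b (p : 'rV[C]_5) g (t : C) :
  is_derive t 1 (hlift a b p g) (dhlift a b p g t).
Proof.
apply: is_derive_row => j; case: (unliftP ord0 j) => [k ->|->].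
  rewrite [X in is_derive _ _ _ X]point_of_w (_ : (fun _ => _) = horner (liftw a b p g k)).
    exact: is_derive_horner.
  by apply/funext => x; rewrite /hlift point_of_w.
rewrite [X in is_derive _ _ _ X]point_of0 (_ : (fun _ => _) = horner (liftz p g)).
  exact: is_derive_horner.
by apply/funext => x; rewrite /hlift point_of0.
Qed.

Lemma near_curve n (c : C -> 'rV[C]_n) d (t : C) (V : set 'rV[C]_n) :
  is_derive t 1 c d -> open V -> V (c t) -> \forall x \near (0 : C), V (c (t + x)).
Proof.
move=> [dc _] oV Vt.
have /differentiable_continuous cc : differentiable c t by apply/derivable1_diffP.
have : \forall x \near t, V (c x) by apply: cc; exact: open_nbhs_nbhs.
by rewrite (near_shift (0 : C)); apply: filterS => x /=; rewrite subr0 addrC.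
Qed.

Lemma eq0_conj_pm (x : C) : x - x^* = 0 -> 'i * x - ('i * x)^* = 0 -> x = 0.
Proof.
rewrite rmorphM /= conjCi mulNr opprK -mulrDr => h1 /eqP.
rewrite mulf_eq0 (negPf (neq0Ci C)) /= => /eqP h2.
have e : 2 * x = (x - x^*) + (x + x^*) by ring.
move: e; rewrite h1 h2 addr0.
by move/eqP; rewrite mulf_eq0 pnatr_eq0 /= => /eqP.
Qed.

Variables (a a' : C) (b b' : R) (V : set 'rV[C]_5) (h : 'rV[C]_5 -> 'rV[C]_5).
Hypotheses (oV : open V) (hV : forall x, V x -> differentiable h x).
Hypothesis hM : forall x, V x -> CRmodel a b x -> CRmodel a' b' (h x).

(** The factor by which the differential of h stretches the vector horiz (see
tangency). *)
Definition multiplier q := 'd h q (horiz a b (q 0 0)) 0 0.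

(** The images under h of real curves of M tangent to w L, where L is horiz,
lie in M'. Taking w = 1 and w = i shows that the image v of L and i v are both
tangent to M', and this forces dw_k = contact dz for each k. *)
Lemma tangency q : V q -> CRmodel a b q ->
  'd h q (horiz a b (q 0 0)) = multiplier q *: horiz a' b' (h q 0 0).
Proof.
move=> Vq Mq; set v := 'd h q _.
apply: pointP => [|k]; first by rewrite [in RHS]mxE point_of0 mulr1.
rewrite [in RHS]mxE point_of_w /multiplier -/v; set f := eqn_form a' b' k.
apply/eqP; rewrite -subr_eq0; apply/eqP.
have i1 : (-1 : C) = (-1)%:C by rewrite rmorphN1.
suff key (w : C) : w * (v 0 (wcoord k) - v 0 0 * contact f (h q 0 0) (h q 0 0)^*)
   - (w * (v 0 (wcoord k) - v 0 0 * contact f (h q 0 0) (h q 0 0)^*))^* = 0.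
  by apply: eq0_conj_pm; [have := key 1; rewrite !mul1r|exact: key].
pose g : {poly C} := w%:P * ('X + 1%:P).
have g1 : g.[-1] = 0 by rewrite /g !hornerE addNr mulr0.
pose c := hlift a b q g.
have c1 : c (-1) = q by exact: hlift_start.
have dc : is_derive (-1 : C) 1 c (w *: horiz a b (q 0 0)).
  apply: is_derive_eq; first exact: is_derive_hlift.
  rewrite i1 dhliftE -i1 -/(c (-1)) c1; congr (_ *: _).
  by rewrite /g derivM derivC derivD derivX derivC !hornerE.
have dF : is_derive (-1 : C) 1 (h \o c) (w *: v).
  apply: is_derive_eq.
    by apply: is_derive_diff_comp dc _; rewrite c1; apply: hV.
  by rewrite c1 linearZ.
have dj j : is_derive (-1 : C) 1 (fun t => h (c t) 0 j) (w * v 0 j).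
  by have := is_derive_coord j dF; rewrite mxE.
have djc j : is_derive (-1 : C) 1 (fun t => (h (c t^*) 0 j)^*) (w * v 0 j)^*.
  by have := dj j; rewrite i1 => /is_derive_conj.
have dS := is_derive_hform (eqn_form_real a' b' k) (dj 0) (djc 0).
have m1c : (-1)^* = -1 :> C by rewrite i1 conj_real.
rewrite m1c c1 in dS; have {}dS := dS erefl erefl.
have dG := is_deriveB (is_deriveB (dj (wcoord k)) (djc (wcoord k))) dS.
have Vc : V (c (-1)) by rewrite c1.
have /near0_realP[r r0 Vr] := near_curve dc oV Vc.
rewrite i1 in dG.
suff G0 : forall s : R, `|s| < r ->
    let x : C := (-1 + s)%:C in
    h (c x) 0 (wcoord k) - (h (c x^*) 0 (wcoord k))^* -
    2 * 'i * hform f (h (c x) 0 0) (h (c x^*) 0 0)^* = 0.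
  have := derive0_real r0 dG G0; rewrite -/f.
  move: (contact f _ _) (v 0 0) (v 0 (wcoord k)) => A x y <-.
  rewrite !(rmorphM, rmorphB) /=; ring.
move=> s sr x; rewrite /x conj_real.
have Vx : V (c (-1 + s)%:C).
  rewrite rmorphD rmorphN1; apply: Vr.
  by rewrite normc_def /= expr0n addr0 sqrtr_sqr ltcR.
have Mx : CRmodel a b (c (-1 + s)%:C) by exact: hlift_in.
have /CRmodelP/(_ k) := hM Vx Mx.
by rewrite -/f => ->; rewrite subrr.
Qed.

End Tangency.

(** * Uniform bounds, and the periods of a loop *)

Section BoundsAndLoops.
Local Open Scope classical_set_scope.
Variable R : realType.
Local Notation C := (Cplx R).

Definition bounded_on T (P : T -> Prop) (F : T -> C) :=
  exists2 K : R, 0 <= K & forall x, P x -> `|F x| <= K%:C.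

Lemma bounded_onC T (P : T -> Prop) (c : C) : bounded_on P (fun _ => c).
Proof.
have : 0 <= `|c| by [].
case E : `|c| => [r i]; rewrite lecE /= => /andP[/eqP i0 r0].
by exists r => // x _; rewrite E i0.
Qed.
Lemma bounded_onD T (P : T -> Prop) (F G : T -> C) : bounded_on P F -> bounded_on P G ->
  bounded_on P (fun x => F x + G x).
Proof.
move=> [K K0 hK] [L L0 hL]; exists (K + L) => [|x Px]; first exact: addr_ge0.
by rewrite rmorphD; apply: le_trans (ler_normD _ _) (lerD (hK _ Px) (hL _ Px)).
Qed.
Lemma bounded_onM T (P : T -> Prop) (F G : T -> C) : bounded_on P F -> bounded_on P G ->
  bounded_on P (fun x => F x * G x).
Proof.
move=> [K K0 hK] [L L0 hL]; exists (K * L) => [|x Px]; first exact: mulr_ge0.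
by rewrite rmorphM normrM ler_pM // ?hK ?hL.
Qed.
Lemma bounded_onX T (P : T -> Prop) (F : T -> C) n : bounded_on P F -> bounded_on P (fun x => F x
  ^+ n).
Proof.
move=> bF; elim: n => [|n ih]; first exact: (bounded_onC _ 1).
by rewrite (_ : (fun x => _) = (fun x => F x * F x ^+ n));
  [exact: bounded_onM|apply/funext => x; rewrite exprS].
Qed.
Lemma bounded_on_conj T (P : T -> Prop) (F : T -> C) : bounded_on P F -> bounded_on P (fun x =>
  (F x)^*).
Proof. by move=> [K K0 hK]; exists K => // x Px; rewrite norm_conjC hK. Qed.

Ltac bounded_on_tac := lazymatch goal with
  | |- bounded_on _ (fun v => @?F v + @?G v) => apply: (@bounded_onD _ _ F G); bounded_on_tac
  | |- bounded_on _ (fun v => @?F v * @?G v) => apply: (@bounded_onM _ _ F G); bounded_on_tac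
  | |- bounded_on _ (fun v => @?F v ^+ _) => apply: (@bounded_onX _ _ F); bounded_on_tac
  | |- bounded_on _ (fun v => (@?F v)^*) => apply: (@bounded_on_conj _ _ F); bounded_on_tac
  | |- _ => first [assumption | exact: bounded_onC]
  end.

Definition in_interval (s : R) := is_true (-1 <= s <= 1).

Lemma bounded_on_horner (p : {poly C}) : bounded_on in_interval (fun s => p.[s%:C]).
Proof.
elim/poly_ind: p => [|p c ih].
  by rewrite (_ : (fun s => _) = fun=> 0); [exact: bounded_onC|apply/funext => s; rewrite
    horner0].
rewrite (_ : (fun s => _) = fun s : R => p.[s%:C] * s%:C + c); last first.
  by apply/funext => s; rewrite !hornerE.
apply: bounded_onD; last exact: bounded_onC.
apply: bounded_onM => //; exists 1 => // s /andP[s1 s2].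
by rewrite normc_def /= expr0n addr0 sqrtr_sqr lecR ler_norml s1.
Qed.

Lemma contact_lipschitz (f : form R) (M : R) :
  exists2 K : R, 0 <= K & forall z u : C, `|z| <= M%:C -> `|u| <= M%:C ->
    `|contact f (z + u) (z + u)^* - contact f z z^*| <= K%:C * `|u|.
Proof.
pose P (x : C * C) := is_true (`|x.1| <= M%:C) /\ is_true (`|x.2| <= M%:C).
have b1 : bounded_on P (fun x => x.1).
  by exists `|M| => // x [h _]; rewrite (le_trans h) // lecR ler_norm.
have b2 : bounded_on P (fun x => x.2).
  by exists `|M| => // x [_ h]; rewrite (le_trans h) // lecR ler_norm.
(* The difference is A u + B (conj u). *)
pose A (x : C * C) : C := let z := x.1 in let y := x.1^* in let u := x.2 in let v := x.2^* in
  2 * 'i * (2 * fal f * (y + v) + 3 * fa f * (2 * z + u) * (y + v)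
   + 2 * fb f * (y + v) ^+ 2).
pose B (x : C * C) : C := let z := x.1 in let y := x.1^* in let u := x.2 in let v := x.2^* in
  2 * 'i * (fc f + 2 * fal f * z + (fal f)^* * (2 * y + v) + 3 * fa f * z ^+ 2
   + (fa f)^* * (3 * y ^+ 2 + 3 * y * v + v ^+ 2) + 2 * fb f * z * (2 * y + v)).
have [KA KA0 hA] : bounded_on P A by rewrite /A; bounded_on_tac.
have [KB KB0 hB] : bounded_on P B by rewrite /B; bounded_on_tac.
exists (KA + KB) => [|z u zM uM]; first exact: addr_ge0.
have -> : contact f (z + u) (z + u)^* - contact f z z^* = A (z, u) * u + B (z, u) * u^*.
  by rewrite /contact /A /B /= rmorphD /=; ring.
apply: le_trans (ler_normD _ _) _; rewrite (normrM (A _)) (normrM (B _)) norm_conjC -mulrDl.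
have Pzu : P (z, u) by split.
by rewrite ler_wpM2r // rmorphD; apply: lerD; [exact: hA|exact: hB].
Qed.

(** Closed plane curves whose moments of order at most two vanish. The moments
without conj g are absent: they vanish on every closed curve. *)
Record loop (g : {poly C}) := Loop {
  loop_start : g.[-1] = 0;
  loop_end : g.[1] = 0;
  loop01 : intp (conjp g * g^`()) = 0;
  loop11 : intp (g * conjp g * g^`()) = 0;
  loop02 : intp (conjp g ^+ 2 * g^`()) = 0 }.

Lemma intp_pow (g : {poly C}) n : intp (g ^+ n * g^`()) =
  n.+1%:R^-1 * (g.[1] ^+ n.+1 - g.[-1] ^+ n.+1).
Proof.
have <- : (n.+1%:R^-1)%:P * (g ^+ n.+1)^`() = g ^+ n * g^`().
  rewrite deriv_exp -[X in _ * X]mulr_natl -(polyC_natr C n.+1) !mulrA -polyCM.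
  by rewrite mulVf ?pnatr_eq0 // mul1r mulrC.
by rewrite intpM intp_deriv !horner_exp.
Qed.

(** After expanding around (z, w), each term of degree less than 4 in e is a
multiple of a moment that vanishes. *)
Lemma intp_loop (f : form R) (g : {poly C}) (e z w : C) : loop g ->
  intp (contactp f (e%:P * g + z%:P) (e%:P * conjp g + w%:P) * (e%:P * g^`())) =
  e ^+ 4 * intp (contactp (Form 0 0 (fa f) (fb f)) g (conjp g) * g^`()).
Proof.
move=> [g0 g1 m01 m11 m02].
have m00 : intp g^`() = 0 by rewrite intp_deriv g0 g1 subrr.
have m10 : intp (g * g^`()) = 0.
  by rewrite -[X in X * _]expr1 intp_pow g0 g1 !expr0n subrr mulr0.
have m20 : intp (g ^+ 2 * g^`()) = 0 by rewrite intp_pow g0 g1 !expr0n subrr mulr0.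
move: (conjp g) m01 m11 m02 => y m01 m11 m02.
have -> : contactp f (e%:P * g + z%:P) (e%:P * y + w%:P) * (e%:P * g^`()) =
  (2 * 'i * e * (fc f * w + 2 * fal f * z * w + (fal f)^* * w ^+ 2 + 3 * fa f * z ^+ 2 * w
     + (fa f)^* * w ^+ 3 + 2 * fb f * z * w ^+ 2))%:P * g^`() +
  (2 * 'i * e ^+ 2 * (2 * fal f * w + 6 * fa f * z * w + 2 * fb f * w ^+ 2))%:P * (g * g^`()) +
  (2 * 'i * e ^+ 2 * (fc f + 2 * fal f * z + 2 * (fal f)^* * w + 3 * fa f * z ^+ 2
     + 3 * (fa f)^* * w ^+ 2 + 4 * fb f * z * w))%:P * (y * g^`()) +
  (2 * 'i * e ^+ 3 * (3 * fa f * w))%:P * (g ^+ 2 * g^`()) +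
  (2 * 'i * e ^+ 3 * (2 * fal f + 6 * fa f * z + 4 * fb f * w))%:P * (g * y * g^`()) +
  (2 * 'i * e ^+ 3 * ((fal f)^* + 3 * (fa f)^* * w + 2 * fb f * z))%:P * (y ^+ 2 * g^`()) +
  (e ^+ 4)%:P * (contactp (Form 0 0 (fa f) (fb f)) g y * g^`()).
  rewrite /contactp /= conjC0; ring.
by rewrite !intpD !intpM m00 m10 m01 m20 m11 m02 !mulr0 !add0r.
Qed.

End BoundsAndLoops.

Section FirstOrderLift.
Local Open Scope classical_set_scope.
Variable R : realType.
Local Notation C := (Cplx R).

Lemma norm_realC (x : R) : `|x%:C : C| = `|x|%:C.
Proof. by rewrite normc_def /= expr0n addr0 sqrtr_sqr. Qed.

Lemma bound_all_coords n (T : Type) (P : T -> Prop) (F : 'I_n -> T -> C) (B : T -> R) :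
  (forall x, P x -> 0 <= B x) ->
  (forall j, exists2 K : R, 0 <= K & forall x, P x -> `|F j x| <= (K * B x)%:C) ->
  exists2 K : R, 0 <= K & forall j x, P x -> `|F j x| <= (K * B x)%:C.
Proof.
move=> B0 h.
have /choice[K hK] : forall j, exists K : R, 0 <= K /\ forall x, P x -> `|F j x| <= (K * B x)%:C.
  by move=> j; have [K K0 hK] := h j; exists K.
exists (\sum_j K j) => [|j x Px]; first by apply: sumr_ge0 => j _; case: (hK j).
apply: le_trans ((hK j).2 x Px) _; rewrite lecR ler_wpM2r ?B0 //.
by rewrite (bigD1 j) //= lerDl; apply: sumr_ge0 => i _; case: (hK i).
Qed.

(** The derivative of the left-hand side in s is e g' times the variation of
contact between p and the moving point, and that variation is O(e). *)
Lemma hlift_first_order a b (p : 'rV[C]_5) (g : {poly C}) : g.[-1] = 0 ->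
  exists2 K : R, 0 <= K & forall e s : R, 0 < e <= 1 -> -1 <= s <= 1 ->
    `|hlift a b p ((e%:C)%:P * g) s%:C - p - (e%:C * g.[s%:C]) *: horiz a b (p 0 0)|
      <= (K * e ^+ 2)%:C.
Proof.
move=> g0.
pose F (j : 'I_5) (x : R * R) : C :=
  (hlift a b p ((x.1%:C)%:P * g) x.2%:C - p - (x.1%:C * g.[x.2%:C]) *: horiz a b (p 0 0)) 0 j.
pose P (x : R * R) := is_true (0 < x.1 <= 1) /\ is_true (-1 <= x.2 <= 1).
have [x _||K K0 hK] := @bound_all_coords 5 _ P F (fun x => x.1 ^+ 2); first exact: exprn_ge0 ||
  exact: sqr_ge0.
  move=> j; case: (unliftP ord0 j) => [k ->|->]; last first.
    exists 0 => // x _; rewrite /F !mxE /hlift /horiz unlift_none /liftz mulr1.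
    by rewrite !hornerE addrK subrr normr0 ler0c ?mulr_ge0 // sqr_ge0.
  have [G G0 hG] := bounded_on_horner g.
  have [G' G'0 hG'] := bounded_on_horner g^`().
  have [M M0 hM] := @bounded_onC R unit (fun=> True) (p 0 0).
  have [L L0 hL] := contact_lipschitz (eqn_form a b k) (M + G).
  exists (4 * (G' * L * G)) => [|[e s] [/= /andP[e0 e1] hs]].
    by rewrite !mulr_ge0.
  set Qk := contact (eqn_form a b k) (p 0 0) (p 0 0)^*.
  pose Pk := liftw a b p ((e%:C)%:P * g) k - (p 0 (wcoord k))%:P - (e%:C * Qk)%:P * g.
  have eF r : Pk.[r] = hlift a b p ((e%:C)%:P * g) r 0 (wcoord k) - p 0 (wcoord k) - (e%:C *
    g.[r]) * Qk.
    by rewrite /Pk /hlift point_of_w !(hornerD, hornerN, hornerM, hornerC); ring.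
  have -> : F (lift ord0 k) (e, s) = Pk.[s%:C] - Pk.[-1].
    rewrite !eF -/(wcoord k) hlift_start ?hornerM ?g0 ?mulr0 // subrr sub0r mul0r oppr0 subr0.
    by rewrite /F /= !mxE /wcoord liftK.
  have -> : 4 * (G' * L * G) * e ^+ 2 = 4 * (G' * L * G * e ^+ 2) by ring.
  apply: (@mean_value_ineq _ (horner Pk) (horner Pk^`())) => // r hr.
    exact: is_derive_horner.
  have -> : Pk^`().[r%:C] = g^`().[r%:C] * e%:C *
      (contact (eqn_form a b k) (p 0 0 + e%:C * g.[r%:C]) (p 0 0 + e%:C * g.[r%:C])^* - Qk).
    rewrite /Pk !derivB derivC subr0 derivM derivC mul0r add0r.
    rewrite /liftw derivD derivC add0r deriv_antideriv derivM derivC mul0r add0r.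
    rewrite !(horner_contactp, horner_conjp, hornerD, hornerN, hornerM, hornerC) /liftz.
    rewrite [_ + p 0 0]addrC /Qk; ring.
  have ne : `|e%:C : C| = e%:C by rewrite norm_realC gtr0_norm.
  have le1 : `|e%:C * g.[r%:C]| <= (e * G)%:C.
    by rewrite normrM ne rmorphM ler_wpM2l ?hG // lecR ltW.
  rewrite !normrM ne.
  have -> : G' * L * G * e ^+ 2 = (G' * e) * (L * (e * G)) by ring.
  rewrite [leRHS]rmorphM; apply: ler_pM => //.
    by rewrite mulr_ge0 // ler0c ltW.
    by rewrite rmorphM ler_wpM2r ?hG' // ler0c ltW.
  rewrite rmorphM.
  apply: le_trans (hL _ _ _ _) _.
  - by apply: le_trans (hM tt I) _; rewrite lecR lerDl.
  - apply: le_trans le1 _; rewrite lecR -[leLHS]add0r lerD //.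
    by rewrite ler_piMl.
  - by rewrite ler_wpM2l // ler0c.
exists K => // e s he hs; apply: rV_norm_le => [|j].
  by rewrite ler0c mulr_ge0 // sqr_ge0.
exact: (hK j (e, s)).
Qed.

End FirstOrderLift.

(** * Differentials, the end of a lifted loop, recentring the target *)

Section Recentring.
Local Open Scope classical_set_scope.
Variable R : realType.
Local Notation C := (Cplx R).

Lemma near0_real_ball (W : normedModType C) (P : W -> Prop) : (\forall v \near (0 : W), P v) ->
  exists2 d : R, 0 < d & forall v : W, `|v| < d%:C -> P v.
Proof.
move=> /nbhs_ballP[d /= /gt0_realC[r r0 ->]] h; exists r => // x xr; apply: h.
by rewrite -ball_normE /= sub0r normrN.
Qed.

Lemma frechet (U W : normedModType C) (h : U -> W) (p : U) : differentiable h p ->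
  forall e : R, 0 < e -> exists2 d : R, 0 < d &
    forall v, `|v| < d%:C -> `|h (p + v) - h p - 'd h p v| <= e%:C * `|v|.
Proof.
move=> /diff_locally/eqaddoP dh e e0; apply: near0_real_ball.
have e0C : 0 < e%:C :> C by rewrite ltcR.
have := dh _ e0C; apply: filterS => v /=.
by rewrite !fctE /= opprD addrA [v + p]addrC.
Qed.

Lemma diff_bounded (U W : normedModType C) (h : U -> W) (p : U) : differentiable h p ->
  exists2 D : R, 0 < D & forall v, `|'d h p v| <= D%:C * `|v|.
Proof.
move=> dh; have cd : continuous ('d h p) by exact: diff_continuous.
have /linear_boundedP/pinfty_ex_gt0[D D0 hD] :=
  (linear_bounded_continuous ('d h p)).2 cd.
by have [r r0 er] := gt0_realC D0; exists r => // v; rewrite -er.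
Qed.

Definition e_w4 : 'rV[C]_5 := point_of 0 (fun k => (k == 3)%:R).

(** The forms of the first three equations have no quartic part, so that only
w_4 moves. *)
Lemma hlift_end a b (p : 'rV[C]_5) (g : {poly C}) (e : R) : loop g ->
  hlift a b p ((e%:C)%:P * g) 1 =
  p + (e%:C ^+ 4 * intp (contactp (Form 0 0 a b%:C) g (conjp g) * g^`())) *: e_w4.
Proof.
move=> lg; have [g0 g1 _ _ _] := lg.
apply: pointP; rewrite /hlift ?point_of0.
  by rewrite !mxE unlift_none mulr0 addr0 /liftz hornerD hornerM g1 mulr0 hornerC add0r.
move=> k; rewrite point_of_w [in RHS]mxE [in RHS]mxE /e_w4 point_of_w hornerD hornerC; congr (_ +
  _).
rewrite -/(intp _) /liftz conjpD conjpM !conjpC conj_real derivM derivC mul0r add0r.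
rewrite intp_loop //.
case: (ord4P k) => -> /=; rewrite ?mulr1 //.
all: rewrite mulr0 (_ : contactp _ _ _ = 0); last by rewrite /contactp /= !(conjC0, mulr0,
  polyC0, mul0r, addr0).
all: by rewrite mul0r -(deriv0 C) intp_deriv !horner0 subrr mulr0.
Qed.

(** The last coordinate seen from a point over z, up to a constant. The forms
of w_2 + i w_3 and w_2 - i w_3 are 8i z (conj z) dz and 4i (conj z)^2 dz, that
of w_1 is 2i (conj z) dz, and polynomials in z contribute the rest: these
cancel the lower terms of the quartic form when its variable is translated. *)
Definition recentre (a : C) (b : C) (z : C) (x : 'rV[C]_5) : C :=
  let w := z^* in
  x 0 (wcoord 3) + (- 6 * a * z - 4 * b * w) * (x 0 (wcoord 1) + 'i * x 0 (wcoord 2)) / 4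
  + (- 3 * a^* * w - 2 * b * z) * (x 0 (wcoord 1) - 'i * x 0 (wcoord 2)) / 2
  + (3 * a * z ^+ 2 + 3 * a^* * w ^+ 2 + 4 * b * z * w) * x 0 (wcoord 0)
  + 2 * 'i * (- a * w * x 0 0 ^+ 3 + (3 * a * z * w + b * w ^+ 2) * x 0 0 ^+ 2
      - (3 * a * z ^+ 2 * w + a^* * w ^+ 3 + 2 * b * z * w ^+ 2) * x 0 0).

Lemma is_derive_recentre a b z (X : C -> 'rV[C]_5) (d t : C) :
  is_derive t 1 X (d *: horiz a b (X t 0 0)) ->
  is_derive t 1 (fun x => recentre a b%:C z (X x))
    (d * contact (Form 0 0 a b%:C) (X t 0 0 - z) (X t 0 0 - z)^*).
Proof.
move=> dX.
have d0 : is_derive t 1 (fun x => X x 0 0) d.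
  by have := is_derive_coord 0 dX; rewrite !mxE unlift_none mulr1.
have dk k : is_derive t 1 (fun x => X x 0 (wcoord k)) (d * contact (eqn_form a b k) (X t 0 0) (X
  t 0 0)^*).
  by have := is_derive_coord (wcoord k) dX; rewrite [X in is_derive _ _ _ X -> _]mxE /horiz
    point_of_w.
have i2 : 'i * 'i = -1 :> C by rewrite -expr2 sqrCi.
have dk0 := dk 0; have dk1 := dk 1; have dk2 := dk 2; have dk3 := dk 3.
rewrite /recentre; eapply is_derive_eq; first by derive_tac.
rewrite /= !(mul0r, mulr0, addr0, add0r, subr0).
move: (X t 0 0) => Z.
have conjNi : (- 'i)^* = 'i :> C by rewrite rmorphN /= conjCi opprK.
have hp : d * contact (eqn_form a b 1) Z Z^* + 'i * (d * contact (eqn_form a b 2) Z Z^*) = d * (8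
  * 'i * Z * Z^*).
  rewrite /contact /= conjNi !conjC1 !conjC0.
  rewrite (_ : 8 * 'i = 4 * 'i * (1 - 'i * 'i)); last by rewrite i2; ring.
  rewrite (_ : 1 * Z^* ^+ 2 = - ('i * 'i) * Z^* ^+ 2); last by rewrite i2 opprK.
  ring.
have hm : d * contact (eqn_form a b 1) Z Z^* - 'i * (d * contact (eqn_form a b 2) Z Z^*) = d * (4
  * 'i * Z^* ^+ 2).
  rewrite /contact /= conjNi !conjC1 !conjC0.
  rewrite (_ : 2 * 1 * Z * Z^* = 2 * - ('i * 'i) * Z * Z^*); last by rewrite i2 opprK.
  rewrite (_ : 4 * 'i = 2 * 'i * (1 - 'i * 'i)); last by rewrite i2; ring.
  ring.
rewrite hp hm /contact /= rmorphB ?conjC0 ?conjC1 /=.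
by field.
Qed.

End Recentring.

(** * The blow-up at a point *)

Section LoopIdentity.
Local Open Scope classical_set_scope.
Variable R : realType.
Local Notation C := (Cplx R).

Lemma norm_real_ex (W : normedModType C) (v : W) : exists2 r : R, 0 <= r & `|v| = r%:C.
Proof.
have : 0 <= `|v| by [].
by case: (`|v|) => r i; rewrite lecE /= => /andP[/eqP -> r0]; exists r.
Qed.

Lemma contact_homog (f : form R) (e : R) (z : C) : fc f = 0 -> fal f = 0 ->
  contact f (e%:C * z) (e%:C * z)^* = e%:C ^+ 3 * contact f z z^*.
Proof. by move=> c0 al0; rewrite /contact c0 al0 conjC0 rmorphM /= conj_real; ring. Qed.

Variables (a a' : C) (b b' : R) (V : set 'rV[C]_5) (h : 'rV[C]_5 -> 'rV[C]_5).
Hypotheses (oV : open V) (hV : forall x, V x -> differentiable h x).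
Hypothesis hM : forall x, V x -> CRmodel a b x -> CRmodel a' b' (h x).
Variable p : 'rV[C]_5.
Hypotheses (Vp : V p) (Mp : CRmodel a b p).
Variables rho Lam : R.
Hypotheses (rho0 : 0 < rho) (Lam0 : 0 <= Lam).
Hypothesis Vrho : forall q, `|q - p| < rho%:C -> V q.
Hypothesis Lrho : forall q, `|q - p| < rho%:C -> CRmodel a b q -> `|multiplier a b h q| <= Lam%:C.

Let l := multiplier a b h p.
Let z' := h p 0 0.
Let f' : form R := Form 0 0 a' b'%:C.
Let scaled_lift e g (t : C) := hlift a b p ((e%:C)%:P * g) t.

Lemma scaled_lift_close (g : {poly C}) : g.[-1] = 0 ->
  exists2 K : R, 0 <= K & forall e s : R, 0 < e <= 1 -> -1 <= s <= 1 ->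
    `|scaled_lift e g s%:C - p| <= (e * K)%:C.
Proof.
move=> g0; have [K1 K10 hK1] := hlift_first_order a b p g0.
have [G G0 hG] := bounded_on_horner g.
have [N N0 hN] := norm_real_ex (horiz a b (p 0 0)).
exists (K1 + G * N) => [|e s he hs]; first by rewrite addr_ge0 // mulr_ge0.
have /andP[e0 e1] := he.
rewrite -[X in `|X|](subrK ((e%:C * g.[s%:C]) *: horiz a b (p 0 0))).
apply: le_trans (ler_normD _ _) _; rewrite mulrDr rmorphD lerD //.
  apply: le_trans (hK1 e s he hs) _; rewrite lecR mulrC expr2 -mulrA.
  by rewrite ler_wpM2l ?(ltW e0) // ler_piMl.
rewrite normrZ hN normrM norm_realC (gtr0_norm e0) [e * (_ * _)]mulrA !rmorphM ler_wpM2r ?ler0c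
  //.
by rewrite ler_wpM2l ?ler0c ?(ltW e0) // hG.
Qed.

(** To first order in e the lift is p + e g horiz, and l is the z-component of
the differential of h at p on horiz. *)
Lemma image_z_close (g : {poly C}) (d : R) : g.[-1] = 0 -> 0 < d ->
  exists2 e0 : R, 0 < e0 & forall e s : R, 0 < e <= 1 -> e < e0 -> -1 <= s <= 1 ->
    `|h (scaled_lift e g s%:C) 0 0 - z' - e%:C * (l * g.[s%:C])| <= (e * d)%:C.
Proof.
move=> g0 d0; have [K1 K10 hK1] := hlift_first_order a b p g0.
have [K2 K20 hK2] := scaled_lift_close g0.
have [D D0 hD] := diff_bounded (hV Vp).
have K2p : 0 < K2 + 1 by rewrite ltr_wpDl.
have d1 : 0 < d / 2 / (K2 + 1) by rewrite !divr_gt0.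
have [r r0 hr] := frechet (hV Vp) d1.
have DK : 0 < D * K1 + 1 by rewrite ltr_wpDl // mulr_ge0 // ltW.
exists (Num.min (r / (K2 + 1)) (d / 2 / (D * K1 + 1))).
  by rewrite lt_min !divr_gt0.
move=> e s he; rewrite lt_min => /andP[er ed] hs; have /andP[e0 e1] := he.
set q := scaled_lift e g s%:C.
have qp := hK2 e s he hs; rewrite -/q in qp.
have qr : `|q - p| < r%:C.
  apply: le_lt_trans qp _; rewrite ltcR.
  by rewrite ltr_pdivlMr // in er; apply: le_lt_trans er; rewrite ler_wpM2l ?(ltW e0) // lerDl.
have := hr _ qr; rewrite [p + _]addrC subrK => h1.
have := hK1 e s he hs; rewrite -/(scaled_lift e g s%:C) -/q; set w := (_ - _ *: _) => h2.
have -> : h q 0 0 - z' - e%:C * (l * g.[s%:C]) =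
   (h q - h p - 'd h p (q - p)) 0 0 + ('d h p w) 0 0.
  have -> : 'd h p w = 'd h p (q - p) - (e%:C * g.[s%:C]) *: 'd h p (horiz a b (p 0 0)).
    by rewrite /w (linearB ('d h p) (q - p)) linearZ.
  rewrite mxE [in RHS]mxE [in RHS]mxE [in RHS]mxE [in RHS]mxE [in RHS]mxE [in RHS]mxE /l
    /multiplier /z'.
  ring.
apply: le_trans (ler_normD _ _) _.
have -> : e * d = e * (d / 2) + e * (d / 2) by field.
rewrite rmorphD; apply: lerD.
  apply: le_trans (coord_le _ _) _; apply: le_trans h1 _.
  apply: (@le_trans _ _ ((d / 2 / (K2 + 1))%:C * (e * K2)%:C)).
    by rewrite ler_wpM2l // ler0c ltW.
  rewrite -rmorphM lecR.
  have -> : d / 2 / (K2 + 1) * (e * K2) = e * (d / 2) * (K2 / (K2 + 1)).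
    by field; rewrite gt_eqF.
  rewrite ger_pMr ?mulr_gt0 ?divr_gt0 //.
  by rewrite ler_pdivrMr // mul1r lerDl.
apply: le_trans (coord_le _ _) _; apply: le_trans (hD _) _.
apply: (@le_trans _ _ (D%:C * (K1 * e ^+ 2)%:C)).
  by rewrite ler_wpM2l // ler0c ltW.
rewrite -rmorphM lecR expr2.
have -> : D * (K1 * (e * e)) = e * (e * (D * K1)) by ring.
rewrite ler_wpM2l ?(ltW e0) //.
rewrite ltr_pdivlMr // in ed; apply: le_trans (ltW ed).
by rewrite ler_wpM2l ?(ltW e0) // lerDl.
Qed.

Lemma is_derive_image (g : {poly C}) (e s : R) : g.[-1] = 0 -> V (scaled_lift e g s%:C) ->
  is_derive (s%:C : C) 1 (fun t => h (scaled_lift e g t))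
    ((e%:C * g^`().[s%:C] * multiplier a b h (scaled_lift e g s%:C)) *: horiz a' b' (h
      (scaled_lift e g s%:C) 0 0)).
Proof.
move=> g0 Vs.
have eg0 : ((e%:C)%:P * g).[-1] = 0 by rewrite hornerM g0 mulr0.
have Ms : CRmodel a b (scaled_lift e g s%:C) by exact: hlift_in.
apply: is_derive_eq.
  exact: (is_derive_diff_comp (is_derive_hlift a b p ((e%:C)%:P * g) s%:C) (hV Vs)).
rewrite dhliftE linearZ -/(scaled_lift e g s%:C) /= (tangency oV hV hM Vs Ms) scalerA.
by rewrite derivM derivC mul0r add0r hornerM hornerC.
Qed.

Let along_w4 (t : C) := recentre a' b'%:C z' (h (p + t *: e_w4 R)).

Lemma derivable_w4 : exists k : C, is_derive (0 : C) 1 along_w4 k.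
Proof.
have dl : is_derive (0 : C) 1 (fun t : C => p + t *: e_w4 R) (e_w4 R).
  apply/is_derive_nearP => e e0; apply: filterE => x.
  by rewrite scale0r addr0 add0r [p + _]addrC addrK subrr normr0 mulr_ge0 // ltW.
have V0 : V (p + (0 : C) *: e_w4 R) by rewrite scale0r addr0.
have dh := is_derive_diff_comp dl (hV V0).
move: ('d _ _ _) dh => v dh.
have dj j : is_derive (0 : C) 1 (fun t => h (p + t *: e_w4 R) 0 j) (v 0 j).
  exact: is_derive_coord dh.
have d0 := dj 0; have d1 := dj (wcoord 0); have d2 := dj (wcoord 1).
have d3 := dj (wcoord 2); have d4 := dj (wcoord 3).
by eexists; rewrite /along_w4 /recentre; derive_tac.
Qed.

Lemma contactp_loop (c : C) (g : {poly C}) (s : R) :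
  (contactp f' (c%:P * g) ((c^*)%:P * conjp g)).[s%:C] = contact f' (c * g.[s%:C]) (c *
    g.[s%:C])^*.
Proof. by rewrite horner_contactp !hornerM !hornerC horner_conjp rmorphM. Qed.

(** Here Psi compares the rescaled last coordinate of the image curve with the
primitive J of its expected derivative. The error er in the z-component is
small, but its derivative is only bounded; subtracting q er amounts to an
integration by parts, after which each term of the derivative of Psi is a
bounded factor times er or times a difference that contact_lipschitz bounds by
er. *)
Lemma core_estimate (g : {poly C}) (k : C) : loop g -> is_derive (0 : C) 1 along_w4 k ->
  let src := intp (contactp (Form 0 0 a b%:C) g (conjp g) * g^`()) in
  let tgt := intp (contactp f' (l%:P * g) ((l^*)%:P * conjp g) * (l%:P * g^`())) in
  exists2 K : R, 0 <= K & forall d : R, 0 < d <= 1 -> `|k * src - tgt| <= (K * d)%:C.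
Proof.
move=> lg dk src tgt; have [g0 g1 _ _ _] := lg.
have [G G0 hG] := bounded_on_horner g.
have [G' G'0 hG'] := bounded_on_horner g^`().
have [L0 L00 hL0] := norm_real_ex (l : C^o).
have [N N0 hN] := norm_real_ex (src : C^o).
have [KL KL0 hKL] := contact_lipschitz f' (L0 * G + 1).
pose q := contactp f' (l%:P * g) ((l^*)%:P * conjp g).
have [Q1 Q10 hQ1] := bounded_on_horner q^`().
have [K2 K20 hK2] := scaled_lift_close g0.
pose K4 := KL * G' * Lam + Q1.
have K40 : 0 <= K4 by rewrite addr_ge0 // !mulr_ge0.
exists (4 * K4 + N) => [|d /andP[d0 d1]]; first by rewrite addr_ge0 // mulr_ge0.
have [e0 e00 hz] := image_z_close g0 d0.
have [r r0 hr] : exists2 r : R, 0 < r & forall x : C, `|x| < r%:C ->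
    `|along_w4 x - along_w4 0 - x * k| <= d%:C * `|x|.
  have /is_derive_nearP/(_ d%:C) := dk.
  rewrite ltcR => /(_ d0)/near0_realP[r r0 hr]; exists r => // x /hr.
  by rewrite add0r.
have [e he [ee0 [eK eN]]] : exists2 e : R, 0 < e <= 1 & e < e0 /\ (e * K2 < rho /\ e * N < r).
  have p1 : 0 < K2 + N + 1 by rewrite ltr_wpDl // addr_ge0.
  pose m := Num.min (Num.min 1 e0) (Num.min rho r).
  have m0 : 0 < m by rewrite !lt_min ltr01 e00 rho0 r0.
  have [m1 me mr mk] : [/\ m <= 1, m <= e0, m <= rho & m <= r].
    by rewrite !ge_min !lexx !orbT.
  have q0 : 0 < (K2 + N + 1) * 2 by rewrite mulr_gt0.
  have eq1 : m / ((K2 + N + 1) * 2) < m.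
    by rewrite ltr_pdivrMr // ltr_pMr //; lra.
  exists (m / ((K2 + N + 1) * 2)); first by rewrite divr_gt0 //= (le_trans (ltW eq1)).
  split; first exact: lt_le_trans eq1 me.
  by split; rewrite mulrAC ltr_pdivrMr //;
    [apply: lt_le_trans (_ : m * ((K2 + N + 1) * 2) <= _)|
     apply: lt_le_trans (_ : m * ((K2 + N + 1) * 2) <= _)];
    rewrite ?ltr_pM2l ?ler_pM2r //; lra.
have /andP[e_gt0 e_le1] := he.
have eC0 : e%:C != 0 :> C by rewrite -(rmorph0 (real_complex R)) (inj_eq (@complexI R)) gt_eqF.
have ne : `|e%:C : C| = e%:C by rewrite norm_realC gtr0_norm.
have close s : -1 <= s <= 1 -> `|scaled_lift e g s%:C - p| < rho%:C.
  by move=> hs; apply: le_lt_trans (hK2 e s he hs) _; rewrite ltcR.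
have eg0 : ((e%:C)%:P * g).[-1] = 0 by rewrite hornerM g0 mulr0.
pose X (t : C) := h (scaled_lift e g t).
pose er (t : C) : C := (X t 0 0 - z') / e%:C - l * g.[t].
have er_le s : -1 <= s <= 1 -> `|er s%:C| <= d%:C.
  move=> hs.
  have -> : er s%:C = (X s%:C 0 0 - z' - e%:C * (l * g.[s%:C])) / e%:C.
    by rewrite /er; field.
  rewrite normrM normfV ne ler_pdivrMr ?ltcR // -rmorphM [d * e]mulrC.
  exact: hz.
pose lm t := multiplier a b h (scaled_lift e g t).
pose J := antideriv (q * (l%:P * g^`())).
pose Psi (t : C) := recentre a' b'%:C z' (X t) / e%:C ^+ 4 - J.[t] - q.[t] * er t.
pose dPsi (t : C) := (contact f' (l * g.[t] + er t) (l * g.[t] + er t)^*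
   - contact f' (l * g.[t]) (l * g.[t])^*) * (g^`().[t] * lm t) - q^`().[t] * er t.
have dP (s : R) : -1 <= s <= 1 -> is_derive (s%:C : C) 1 Psi (dPsi s%:C).
  move=> hs; have Vs := Vrho (close _ hs).
  have dX := is_derive_image g0 Vs; rewrite -/(X _) in dX.
  have dT := is_derive_recentre z' dX.
  have d0' : is_derive (s%:C : C) 1 (fun t => X t 0 0) (e%:C * g^`().[s%:C] * lm s%:C).
    by have := is_derive_coord 0 dX; rewrite !mxE unlift_none mulr1.
  have dg := is_derive_horner g s%:C.
  have dq := is_derive_horner q s%:C.
  have dJ := is_derive_horner J s%:C.
  rewrite /Psi /er; apply: is_derive_eq; rewrite /GRing.scale /=.
  rewrite /J deriv_antideriv (hornerM q) (hornerM l%:P) hornerC (contactp_loop l g s : q.[s%:C] =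
    _).
  have -> : X s%:C 0 0 - z' = e%:C * (l * g.[s%:C] + er s%:C) by rewrite /er; field.
  rewrite contact_homog // /dPsi -/f' -/(lm _).
  rewrite [X in _ - X]addrC.
  by field.
have hdP (s : R) : -1 <= s <= 1 -> `|dPsi s%:C| <= (K4 * d)%:C.
  move=> hs; rewrite /dPsi; apply: le_trans (ler_normB _ _) _.
  have -> : K4 * d = (KL * d) * (G' * Lam) + Q1 * d by rewrite /K4; ring.
  rewrite [leRHS]rmorphD; apply: lerD; last first.
    by rewrite normrM rmorphM ler_pM ?hQ1 ?er_le.
  rewrite normrM.
  rewrite [leRHS]rmorphM; apply: ler_pM => //; last first.
    rewrite normrM rmorphM; apply: ler_pM => //; first exact: hG'.
    by apply: Lrho; [exact: close|exact: hlift_in].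
  have le1 : `|l * g.[s%:C]| <= (L0 * G)%:C.
    by rewrite normrM hL0 rmorphM ler_wpM2l ?ler0c // hG.
  apply: le_trans (hKL _ _ _ _) _.
  - by apply: le_trans le1 _; rewrite lecR lerDl.
  - apply: le_trans (er_le _ hs) _; rewrite lecR; apply: le_trans d1 _.
    by rewrite lerDr mulr_ge0.
  - by rewrite rmorphM ler_wpM2l ?ler0c // er_le.
have iv : -1 <= (1 : R) <= 1 by apply/andP; split; lra.
have est := mean_value_ineq iv dP hdP.
have q1 (t : R) : g.[t%:C] = 0 -> q.[t%:C] = 0.
  by move=> gt; rewrite [LHS]contactp_loop gt mulr0 /contact /= !conjC0; ring.
have i1 : (-1 : C) = (-1)%:C by rewrite rmorphN1.
have P1 : Psi 1 = recentre a' b'%:C z' (X 1) / e%:C ^+ 4 - tgt.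
  by rewrite /Psi (q1 1 g1) mul0r subr0.
have Pm1 : Psi (-1) = along_w4 0 / e%:C ^+ 4.
  rewrite /Psi (_ : q.[-1] = 0) ?mul0r ?subr0; last by rewrite i1 q1 // -i1.
  by rewrite antideriv_base subr0 /along_w4 scale0r addr0 /X /scaled_lift hlift_start.
have X1 : recentre a' b'%:C z' (X 1) = along_w4 (e%:C ^+ 4 * src) by rewrite /X /scaled_lift
  hlift_end.
have hS : `|e%:C ^+ 4 * src| <= (e ^+ 4 * N)%:C.
  by rewrite normrM normrX ne hN rmorphM rmorphXn.
have hSr : `|e%:C ^+ 4 * src| < r%:C.
  apply: le_lt_trans hS _; rewrite ltcR; apply: le_lt_trans eN.
  by rewrite ler_wpM2r // exprS ger_pMr // exprn_ile1 // ltW.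
have est2 := hr _ hSr.
have -> : k * src - tgt = (Psi 1 - Psi (-1)) -
    (along_w4 (e%:C ^+ 4 * src) - along_w4 0 - e%:C ^+ 4 * src * k) / e%:C ^+ 4.
  by rewrite P1 Pm1 X1; field.
apply: le_trans (ler_normB _ _) _.
have -> : (4 * K4 + N) * d = 4 * (K4 * d) + N * d by ring.
rewrite [leRHS]rmorphD; apply: lerD; first exact: est.
rewrite normrM normfV normrX ne ler_pdivrMr ?exprn_gt0 ?ltcR //.
apply: le_trans est2 _.
have -> : (N * d)%:C * e%:C ^+ 4 = d%:C * (e ^+ 4 * N)%:C :> C.
  by rewrite !rmorphM; ring.
by rewrite ler_wpM2l // ler0c ltW.
Qed.

Lemma loop_identity : exists k : C, forall g : {poly C}, loop g ->
  k * intp (contactp (Form 0 0 a b%:C) g (conjp g) * g^`()) =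
  intp (contactp f' (l%:P * g) ((l^*)%:P * conjp g) * (l%:P * g^`())).
Proof.
have [k dk] := derivable_w4; exists k => g lg.
have [K K0 hK] := core_estimate lg dk.
apply/eqP; rewrite -subr_eq0; apply/eqP; set x := _ - _ in hK *.
have [r r0 xr] := norm_real_ex (x : C^o).
apply/eqP; rewrite -normr_eq0 xr; apply/eqP; congr (_%:C).
have hr (d : R) : 0 < d <= 1 -> r <= K * d by move=> /hK; rewrite xr lecR.
apply/eqP; rewrite eq_le r0 andbT leNgt; apply/negP => rp.
have K1 : 0 < K + r by rewrite ltr_wpDl.
have := hr (r / (K + r) / 2).
rewrite !divr_gt0 //=.
have le1 : r / (K + r) <= 1 by rewrite ler_pdivrMr // mul1r lerDr.
move=> /(_ _)/wrap[]; first by lra.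
apply/negP; rewrite -ltNge.
have -> : K * (r / (K + r) / 2) = r * (K / (K + r)) / 2 by field; rewrite gt_eqF.
have : K / (K + r) <= 1 by rewrite ler_pdivrMr // mul1r lerDl ltW.
by nra.
Qed.
End LoopIdentity.

(** * A loop with vanishing lower moments *)

Section ExplicitLoop.
Variable R : realType.
Local Notation C := (Cplx R).

Lemma intpXn n : intp ('X^n : {poly C}) = (1 - (-1) ^+ n.+1) / n.+1%:R.
Proof.
have -> : 'X^n = (n.+1%:R^-1)%:P * ('X^(n.+1))^`() :> {poly C}.
  rewrite derivXn -[X in _ * X]mulr_natl -(polyC_natr C n.+1) mulrA -polyCM.
  by rewrite mulVf ?pnatr_eq0 // mul1r.
by rewrite intpM intp_deriv !hornerXn expr1n mulrC.
Qed.

(** The primitive of an odd polynomial is even. *)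
Lemma intp_odd (p : {poly C}) : p \Po (- 'X) = - p -> intp p = 0.
Proof.
move=> po.
have dq : (antideriv p \Po (- 'X) - antideriv p)^`() = 0.
  rewrite derivB deriv_comp derivN derivX deriv_antideriv po.
  by rewrite mulrN1 opprK subrr.
rewrite /intp; have := antideriv_base p; move: (antideriv p) dq => q dq qb.
have := deriv0_const 0 dq.
rewrite !(hornerD, hornerN) horner_comp !hornerE oppr0 subrr => /(congr1 (fun r : {poly C} =>
  r.[1])).
rewrite !(hornerD, hornerN) horner_comp !hornerE.
by rewrite qb sub0r => /eqP; rewrite oppr_eq0 => /eqP.
Qed.

(** loopx is even and loopy is odd, which makes the integrals of y^2 dx and x
y^2 dx vanish. Moreover loopy is proportional to the difference P_7 - P_5 of
Legendre polynomials: it vanishes at both ends and is orthogonal to t and t^3,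
which makes the integrals of y dx and x y dx vanish, but it is not orthogonal
to t^5. *)
Definition loopx : {poly C} := 1 - 'X^2.
Definition loopy : {poly C} := 5%:P * 'X - 35%:P * 'X^3 + 63%:P * 'X^5 - 33%:P * 'X^7.

Lemma intp_exact (p : {poly C}) : p.[1] = 0 -> p.[-1] = 0 -> intp p^`() = 0.
Proof. by move=> h1 h2; rewrite intp_deriv h1 h2 subrr. Qed.

Lemma deriv_loopx : loopx^`() = - 2 * 'X.
Proof. by rewrite /loopx derivB derivC derivXn sub0r mulr2n; ring. Qed.
Lemma loopx1 : loopx.[1] = 0. Proof. by rewrite /loopx !hornerE expr1n subrr. Qed.
Lemma loopxm1 : loopx.[-1] = 0. Proof. by rewrite /loopx !hornerE sqrrN expr1n subrr. Qed.
Lemma horner_loopy (t : C) : loopy.[t] = 5 * t - 35 * t ^+ 3 + 63 * t ^+ 5 - 33 * t ^+ 7.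
Proof. by rewrite /loopy !(hornerD, hornerN, hornerM, hornerXn, hornerX, hornerC). Qed.
Lemma loopy1 : loopy.[1] = 0.
Proof. by rewrite horner_loopy; ring. Qed.
Lemma loopym1 : loopy.[-1] = 0.
Proof. by rewrite horner_loopy; ring. Qed.

Lemma loopx_even : loopx \Po (- 'X) = loopx.
Proof. by rewrite /loopx comp_polyB comp_Xn_poly comp_polyC sqrrN. Qed.
Lemma loopy_odd : loopy \Po (- 'X) = - loopy.
Proof.
rewrite /loopy !(comp_polyB, comp_polyD, comp_polyM, comp_Xn_poly, comp_polyX, comp_polyC).
ring.
Qed.
Lemma deriv_loopx_odd : loopx^`() \Po (- 'X) = - loopx^`().
Proof.
rewrite deriv_loopx (_ : - 2 * 'X = (- 2)%:P * 'X); last by rewrite polyCN polyC_natr.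
by rewrite comp_polyM comp_polyC comp_polyX mulrN.
Qed.

Lemma int_y_dx : intp (loopy * loopx^`()) = 0.
Proof.
have -> : loopy * loopx^`() = (-10)%:P * 'X^2 + 70%:P * 'X^4 + (-126)%:P * 'X^6 + 66%:P * 'X^8.
  by rewrite deriv_loopx /loopy !(polyCN, polyC_natr); ring.
by rewrite !intpD !intpM !intpXn; field.
Qed.

Lemma int_xy_dx : intp (loopx * loopy * loopx^`()) = 0.
Proof.
have -> : loopx * loopy * loopx^`() = loopy * loopx^`() +
   (10%:P * 'X^4 + (-70)%:P * 'X^6 + 126%:P * 'X^8 + (-66)%:P * 'X^10).
  by rewrite deriv_loopx /loopx /loopy !(polyCN, polyC_natr); ring.
by rewrite intpD int_y_dx !intpD !intpM !intpXn; field.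
Qed.

Lemma int_xxy_dx_neq0 : intp (loopx ^+ 2 * loopy * loopx^`()) != 0.
Proof.
have -> : loopx ^+ 2 * loopy * loopx^`() = (2 * loopx - 1) * loopy * loopx^`() +
   ((-10)%:P * 'X^6 + 70%:P * 'X^8 + (-126)%:P * 'X^10 + 66%:P * 'X^12).
  by rewrite deriv_loopx /loopx /loopy !(polyCN, polyC_natr); ring.
have -> : (2 * loopx - 1) * loopy * loopx^`() = 2%:P * (loopx * loopy * loopx^`()) + (-1)%:P *
  (loopy * loopx^`()).
  by rewrite polyCN polyC_natr polyC1; ring.
rewrite !intpD !intpM int_y_dx int_xy_dx !mulr0 !add0r !intpXn.
set v := _ + _; apply/eqP => v0.
(* 63 * 143 clears the denominators 7, 9, 11 and 13. *)
have e : v * 63 * 143 = - 512 by rewrite /v; field.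
by move/eqP: e; rewrite v0 !mul0r eq_sym oppr_eq0 pnatr_eq0.
Qed.

Lemma int_yy_dx : intp (loopy ^+ 2 * loopx^`()) = 0.
Proof. by apply: intp_odd; rewrite comp_polyM expr2 comp_polyM loopy_odd deriv_loopx_odd; ring.
  Qed.
Lemma int_xyy_dx : intp (loopx * loopy ^+ 2 * loopx^`()) = 0.
Proof. by apply: intp_odd; rewrite !comp_polyM loopy_odd deriv_loopx_odd loopx_even; ring. Qed.

Lemma conj_loopx : conjp loopx = loopx.
Proof. by rewrite /loopx /conjp rmorphB rmorph1 /= map_polyXn. Qed.
Lemma conj_loopy : conjp loopy = loopy.
Proof.
have c n : conjp ((n%:R : C)%:P * 'X) = (n%:R : C)%:P * 'X by rewrite conjpM conjpC rmorph_nat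
  /conjp map_polyX.
have cn n m : conjp ((n%:R : C)%:P * 'X^m) = (n%:R : C)%:P * 'X^m by rewrite conjpM conjpC
  rmorph_nat /conjp map_polyXn.
by rewrite /loopy [LHS]rmorphB rmorphD rmorphB /= -!/(conjp _) c !cn.
Qed.

End ExplicitLoop.

(* Keeps unification from computing integrals of concrete polynomials. *)
Opaque intp antideriv.
Section LoopMoments.
Variable R : realType.
Local Notation C := (Cplx R).
Variables x y : {poly C}.
Hypotheses (x1 : x.[1] = 0) (xm : x.[-1] = 0) (y1 : y.[1] = 0) (ym : y.[-1] = 0).
Hypotheses (conj_loopx : conjp x = x) (conj_loopy : conjp y = y).
Hypotheses (int_y_dx : intp (y * x^`()) = 0) (int_xy_dx : intp (x * y * x^`()) = 0).
Hypotheses (int_yy_dx : intp (y ^+ 2 * x^`()) = 0) (int_xyy_dx : intp (x * y ^+ 2 * x^`()) = 0).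

Lemma intp_pow0 (g : {poly C}) n : g.[1] = 0 -> g.[-1] = 0 -> intp (g ^+ n * g^`()) = 0.
Proof. by move=> h1 h2; rewrite intp_pow h1 h2 !expr0n subrr mulr0. Qed.
Lemma intp_pow1 (g : {poly C}) : g.[1] = 0 -> g.[-1] = 0 -> intp (g * g^`()) = 0.
Proof. by move=> h1 h2; rewrite -[X in X * _]expr1 intp_pow0. Qed.

Lemma intp_exact0 p : intp (x * p)^`() = 0.
Proof. by apply: intp_exact; rewrite hornerM ?x1 ?xm mul0r. Qed.

(** This integral and the next ones reduce by parts to integrals against dx. *)
Lemma int_x_dy : intp (x * y^`()) = 0.
Proof.
have -> : x * y^`() = (x * y)^`() + (-1)%:P * (y * x^`()).
  by rewrite derivM polyCN polyC1; ring.
by rewrite intpD intpM intp_exact0 int_y_dx mulr0 addr0.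
Qed.
Lemma int_xx_dy : intp (x ^+ 2 * y^`()) = 0.
Proof.
have -> : x ^+ 2 * y^`() = (x * (x * y))^`() + (-2)%:P * (x * y * x^`()).
  by rewrite !derivM polyCN polyC_natr; ring.
by rewrite intpD intpM intp_exact0 int_xy_dx mulr0 addr0.
Qed.
Lemma int_xy_dy : intp (x * y * y^`()) = 0.
Proof.
have : intp (2%:P * (x * y * y^`())) = 0.
  have -> : 2%:P * (x * y * y^`()) = (x * (y * y))^`() + (-1)%:P * (y ^+ 2 * x^`()).
    by rewrite !derivM polyCN polyC_natr polyC1; ring.
  by rewrite intpD intpM intp_exact0 int_yy_dx mulr0 addr0.
by rewrite intpM => /eqP; rewrite mulf_eq0 pnatr_eq0 => /eqP.
Qed.
Lemma int_xxy_dy : intp (x ^+ 2 * y * y^`()) = 0.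
Proof.
have : intp (2%:P * (x ^+ 2 * y * y^`())) = 0.
  have -> : 2%:P * (x ^+ 2 * y * y^`()) = (x * (x * (y * y)))^`() + (-2)%:P * (x * y ^+ 2 *
    x^`()).
    by rewrite !derivM polyCN polyC_natr; ring.
  by rewrite intpD intpM intp_exact0 int_xyy_dx mulr0 addr0.
by rewrite intpM => /eqP; rewrite mulf_eq0 pnatr_eq0 => /eqP.
Qed.
Lemma int_xxx_dy : intp (x ^+ 3 * y^`()) = - (3 * intp (x ^+ 2 * y * x^`())).
Proof.
have -> : x ^+ 3 * y^`() = (x * (x * (x * y)))^`() + (-3)%:P * (x ^+ 2 * y * x^`()).
  by rewrite !derivM polyCN polyC_natr; ring.
by rewrite intpD intpM intp_exact0 add0r mulNr.
Qed.
Lemma int_xyy_dy : intp (x * y ^+ 2 * y^`()) = - (intp (y ^+ 3 * x^`()) / 3).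
Proof.
have h : 3 * intp (x * y ^+ 2 * y^`()) = - intp (y ^+ 3 * x^`()).
  rewrite -intpM.
  have -> : 3%:P * (x * y ^+ 2 * y^`()) = (x * (y * (y * y)))^`() + (-1)%:P * (y ^+ 3 * x^`()).
    by rewrite !derivM polyCN polyC_natr polyC1; ring.
  by rewrite intpD intpM intp_exact0 add0r mulN1r.
by rewrite -mulNr -h [RHS]mulrC mulKf ?pnatr_eq0.
Qed.

Definition loop_comb (u v : C) : {poly C} := u%:P * x + v%:P * y.

Lemma conj_loop_comb u v : conjp (loop_comb u v) = loop_comb u^* v^*.
Proof. by rewrite /loop_comb conjpD !conjpM !conjpC conj_loopx conj_loopy. Qed.
Lemma deriv_loop_comb u v : (loop_comb u v)^`() = u%:P * x^`() + v%:P * y^`().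
Proof. by rewrite /loop_comb derivD !derivM !derivC !mul0r !add0r. Qed.
Lemma loop_combM c u v : c%:P * loop_comb u v = loop_comb (c * u) (c * v).
Proof. by rewrite /loop_comb !polyCM; ring. Qed.

(** All moments of order at most two of the real curve (x, y) vanish, hence
those of its images under real-linear maps into the complex plane. *)
Lemma loop_comb_is_loop u v : loop (loop_comb u v).
Proof.
have hE t : (loop_comb u v).[t] = u * x.[t] + v * y.[t] by rewrite /loop_comb !(hornerD, hornerM,
  hornerC).
have cg := conj_loop_comb u v; have dg := deriv_loop_comb u v.
split; first by rewrite hE xm ym !mulr0 addr0.
- by rewrite hE x1 y1 !mulr0 addr0.
- rewrite cg dg /loop_comb.
  rewrite (_ : _ * _ = (u^* * u)%:P * (x * x^`()) + (u^* * v)%:P * (x * y^`())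
     + (v^* * u)%:P * (y * x^`()) + (v^* * v)%:P * (y * y^`())); last by rewrite !polyCM; ring.
  by rewrite !intpD !intpM !intp_pow1 // int_x_dy int_y_dx !mulr0 !addr0.
- rewrite cg dg /loop_comb.
  rewrite (_ : _ * _ = (u * u^* * u)%:P * (x ^+ 2 * x^`()) + (u * u^* * v)%:P * (x ^+ 2 * y^`())
     + (u * v^* * u + v * u^* * u)%:P * (x * y * x^`()) + (u * v^* * v + v * u^* * v)%:P * (x * y
       * y^`())
     + (v * v^* * u)%:P * (y ^+ 2 * x^`()) + (v * v^* * v)%:P * (y ^+ 2 * y^`()));
    last by rewrite !(polyCM, polyCD); ring.
  by rewrite !intpD !intpM !intp_pow0 // int_xx_dy int_xy_dx int_xy_dy int_yy_dx !mulr0 !addr0.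
- rewrite cg dg /loop_comb.
  rewrite (_ : _ * _ = (u^* * u^* * u)%:P * (x ^+ 2 * x^`()) + (u^* * u^* * v)%:P * (x ^+ 2 *
    y^`())
     + (2 * u^* * v^* * u)%:P * (x * y * x^`()) + (2 * u^* * v^* * v)%:P * (x * y * y^`())
     + (v^* * v^* * u)%:P * (y ^+ 2 * x^`()) + (v^* * v^* * v)%:P * (y ^+ 2 * y^`()));
    last by rewrite !(polyCM, polyCD, polyC_natr); ring.
  by rewrite !intpD !intpM !intp_pow0 // int_xx_dy int_xy_dx int_xy_dy int_yy_dx !mulr0 !addr0.
Qed.

Lemma intp_cubic (c30 c21 c12 c03 u v : C) (P : {poly C}) :
  P = c30%:P * x ^+ 3 + c21%:P * (x ^+ 2 * y) + c12%:P * (x * y ^+ 2) + c03%:P * y ^+ 3 ->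
  intp (P * (loop_comb u v)^`()) =
    (c21 * u - 3 * c30 * v) * intp (x ^+ 2 * y * x^`())
     + (c03 * u - c12 * v / 3) * intp (y ^+ 3 * x^`()).
Proof.
move=> ->; rewrite deriv_loop_comb.
have -> : (c30%:P * x ^+ 3 + c21%:P * (x ^+ 2 * y) + c12%:P * (x * y ^+ 2) + c03%:P * y ^+ 3)
    * (u%:P * x^`() + v%:P * y^`()) =
  (c30 * u)%:P * (x ^+ 3 * x^`()) + (c30 * v)%:P * (x ^+ 3 * y^`())
  + (c21 * u)%:P * (x ^+ 2 * y * x^`()) + (c21 * v)%:P * (x ^+ 2 * y * y^`())
  + (c12 * u)%:P * (x * y ^+ 2 * x^`()) + (c12 * v)%:P * (x * y ^+ 2 * y^`())
  + (c03 * u)%:P * (y ^+ 3 * x^`()) + (c03 * v)%:P * (y ^+ 3 * y^`()).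
  by rewrite !polyCM; ring.
rewrite !intpD !intpM (intp_pow0 _ x1 xm) (intp_pow0 _ y1 ym) int_xxx_dy int_xxy_dy int_xyy_dx
  int_xyy_dy.
by move: (intp (x ^+ 2 * y * x^`())) (intp (y ^+ 3 * x^`())) => m n; field.
Qed.

Lemma intp_form (a b u v u' v' : C) :
  intp (contactp (Form 0 0 a b) (loop_comb u v) (loop_comb u' v') * (loop_comb u v)^`()) =
  2 * 'i * (3 * (u * v' - u' * v) * (a * u ^+ 2 + a^* * u' ^+ 2) + 4 * b * u * u' * (u * v' - u'
    * v))
     * intp (x ^+ 2 * y * x^`())
  + 2 * 'i * ((3 * a * v ^+ 2 * v' + a^* * v' ^+ 3 + 2 * b * v * v' ^+ 2) * u
     - (a * (v ^+ 2 * u' + 2 * u * v * v') + a^* * u' * v' ^+ 2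
        + 2 / 3 * b * (2 * v * u' * v' + u * v' ^+ 2)) * v) * intp (y ^+ 3 * x^`()).
Proof.
rewrite (@intp_cubic
  (2 * 'i * (3 * a * (u ^+ 2 * u') + a^* * u' ^+ 3 + 2 * b * (u * u' ^+ 2)))
  (2 * 'i * (3 * a * (2 * u * v * u' + u ^+ 2 * v') + 3 * a^* * (u' ^+ 2 * v')
      + 2 * b * (v * u' ^+ 2 + 2 * u * u' * v')))
  (2 * 'i * (3 * a * (v ^+ 2 * u' + 2 * u * v * v') + 3 * a^* * (u' * v' ^+ 2)
      + 2 * b * (2 * v * u' * v' + u * v' ^+ 2)))
  (2 * 'i * (3 * a * (v ^+ 2 * v') + a^* * v' ^+ 3 + 2 * b * (v * v' ^+ 2)))).
  by move: (intp (x ^+ 2 * y * x^`())) (intp (y ^+ 3 * x^`())) (a^*) ('i) => m n a' i; field.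
rewrite /contactp /loop_comb /= conjC0 !mulr0 !polyC0 !mul0r !add0r.
move: (a^*) => a'; rewrite !polyCM.
move: ('i) => i; rewrite !polyCD.
rewrite !polyCM ?polyC_natr.
ring.
Qed.

(** The period of u x + v y has a part linear in v and a part cubic in v, the
quadratic part being a multiple of integrals that vanish. Combining v with 2 v
eliminates the cubic part, and only the integral of x^2 y dx is left. *)
Lemma intp_loop_comb (a b u v u' v' : C) :
  8 * intp (contactp (Form 0 0 a b) (loop_comb u v) (loop_comb u' v') * (loop_comb u v)^`())
   - intp (contactp (Form 0 0 a b) (loop_comb u (2 * v)) (loop_comb u' (2 * v')) * (loop_comb u
     (2 * v))^`()) =
  intp (x ^+ 2 * y * x^`()) * (12 * 'i) * (u * v' - u' * v) *
     (3 * a * u ^+ 2 + 3 * a^* * u' ^+ 2 + 4 * b * u * u').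
Proof.
rewrite !intp_form.
by move: (intp (x ^+ 2 * y * x^`())) (intp (y ^+ 3 * x^`())) (a^*) ('i) => m n a' i; field.
Qed.

End LoopMoments.

(** * From loop periods to the ratio *)

Section Ratio.
Variable R : realType.
Local Notation C := (Cplx R).

(** For v = i u the two sides of intp_loop_comb are multiples of 3 a u^2 + 3
conj (a u^2) + 4 b |u|^2 and of its analogue for a', b' and l u. Comparing
them for u = 1, i and 1 + i gives k b = b' |l|^4 and k a = a' l^3 (conj l). *)
Lemma ratio_of_loops (a a' k l : C) (b b' : R) : l != 0 -> b != 0 -> b' != 0 ->
  (forall g : {poly C}, loop g ->
    k * intp (contactp (Form 0 0 a b%:C) g (conjp g) * g^`()) =
    intp (contactp (Form 0 0 a' b'%:C) (l%:P * g) ((l^*)%:P * conjp g) * (l%:P * g^`()))) ->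
  a * a^* / (b%:C : C) ^+ 2 = a' * a'^* / (b'%:C : C) ^+ 2.
Proof.
move=> l0 b0 b'0 H.
have bC (c : R) : c != 0 -> c%:C != 0 :> C.
  by rewrite -(rmorph0 (real_complex R)) (inj_eq (@complexI R)).
set B := b%:C : C; set B' := b'%:C : C.
have B0 : B != 0 by exact: bC.
have B'0 : B' != 0 by exact: bC.
have lp := loop_comb_is_loop (loopx1 R) (loopxm1 R) (loopy1 R) (loopym1 R) (conj_loopx R)
  (conj_loopy R)
  (int_y_dx R) (int_xy_dx R) (int_yy_dx R).
have cg := conj_loop_comb (conj_loopx R) (conj_loopy R).
have pg := intp_loop_comb (loopx1 R) (loopxm1 R) (loopy1 R) (loopym1 R) (int_xyy_dx R).
have m0 := int_xxy_dx_neq0 R.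
move: (loopx R) (loopy R) lp cg pg m0 => x y lp cg pg m0.
have key (u : C) : u != 0 ->
    k * (3 * a * u ^+ 2 + 3 * a^* * u^* ^+ 2 + 4 * B * u * u^*) =
    l * l^* * (3 * a' * (l * u) ^+ 2 + 3 * a'^* * (l^* * u^*) ^+ 2 + 4 * B' * (l * u) * (l^* *
      u^*)).
  move=> u0; pose v := 'i * u.
  have H1 := H _ (lp u v); have H2 := H _ (lp u (2 * v)).
  have dl w : l%:P * (loop_comb x y u w)^`() = (loop_comb x y (l * u) (l * w))^`().
    by rewrite -loop_combM derivM derivC mul0r add0r.
  rewrite !cg !loop_combM !dl in H1 H2.
  have c2 : (2 * v)^* = 2 * v^* by rewrite rmorphM /= rmorph_nat.
  rewrite c2 ![_ * (2 * _)]mulrCA in H2.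
  have P := pg a B u v u^* v^*.
  have P' := pg a' B' (l * u) (l * v) (l^* * u^*) (l^* * v^*).
  have E : k * (intp (x ^+ 2 * y * x^`()) * (12 * 'i) * (u * v^* - u^* * v) *
     (3 * a * u ^+ 2 + 3 * a^* * u^* ^+ 2 + 4 * B * u * u^*)) = 
     intp (x ^+ 2 * y * x^`()) * (12 * 'i) * (l * u * (l^* * v^*) - l^* * u^* * (l * v)) *
      (3 * a' * (l * u) ^+ 2 + 3 * a'^* * (l^* * u^*) ^+ 2 + 4 * B' * (l * u) * (l^* * u^*)).
    by rewrite -P -P' -H1 -H2 mulrBr [k * (8 * _)]mulrCA.
  have v' : v^* = - 'i * u^* by rewrite /v rmorphM /= conjCi.
  have c0 : intp (x ^+ 2 * y * x^`()) * (12 * 'i) * (- 2 * 'i) * (u * u^*) != 0.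
    by rewrite !mulf_neq0 ?conjC_eq0 ?oppr_eq0 ?pnatr_eq0 ?neq0Ci.
  apply: (mulfI c0); move: E; rewrite v' /v.
  move: (intp _) ('i) (u^*) (l^*) (a^*) (a'^*) => m i uc lc ac ac' E.
  apply: etrans (etrans _ E) _; ring.
have i2 : 'i * 'i = -1 :> C by rewrite -expr2 sqrCi.
have k1 := key 1 (oner_neq0 _).
have k2 := key 'i (neq0Ci _).
have i1 : 1 + 'i != 0 :> C.
  apply/eqP => h; have := i2; have -> : 'i = -1 :> C by apply/eqP; rewrite -addr_eq0 addrC h.
  by move/eqP; rewrite mulrNN mulr1 -addr_eq0 -mulr2n pnatr_eq0.
have k3 := key _ i1.
rewrite conjC1 in k1; rewrite conjCi in k2; rewrite rmorphD /= conjC1 conjCi in k3.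
have n0 : k * B = B' * (l * l^*) ^+ 2 /\ k * a = l * l^* * (a' * l ^+ 2) /\
    k * a^* = l * l^* * (a'^* * l^* ^+ 2).
  have i0 : 'i != 0 :> C by exact: neq0Ci.
  move: ('i) (l^*) (a^*) (a'^*) i0 i2 k1 k2 k3 => i lc ac ac' i0 i2 k1 k2 k3.
  pose A := a' * l ^+ 2; pose A' := ac' * lc ^+ 2; pose n := l * lc.
  have e1 : k * (3 * (a + ac) + 4 * B) = n * (3 * (A + A') + 4 * B' * n).
    by apply: etrans (etrans _ k1) _; rewrite /A /A' /n; ring.
  have e2 : k * (- 3 * (a + ac) + 4 * B) = n * (- 3 * (A + A') + 4 * B' * n).
    have : i * i * (k * (3 * (a + ac) - 4 * B)) = i * i * (n * (3 * (A + A') - 4 * B' * n)).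
      by apply: etrans (etrans _ k2) _; rewrite /A /A' /n; ring.
    rewrite i2 => h; apply: etrans (etrans _ h) _; ring.
  have e3 : k * (6 * i * (a - ac) + 8 * B) = n * (6 * i * (A - A') + 8 * B' * n).
    have : k * (6 * i * (a - ac) + 8 * B) + (i * i + 1) * (k * (3 * (a + ac) - 4 * B)) =
           n * (6 * i * (A - A') + 8 * B' * n) + (i * i + 1) * (n * (3 * (A + A') - 4 * B' * n)).
      by apply: etrans (etrans _ k3) _; rewrite /A /A' /n; ring.
    by rewrite i2 addNr !mul0r !addr0.
  have c8 : 8 != 0 :> C by rewrite pnatr_eq0.
  have c6 : 6 != 0 :> C by rewrite pnatr_eq0.
  have c12 : 12 * i != 0 by rewrite mulf_neq0 // pnatr_eq0.
  have f1 : k * B = B' * n ^+ 2.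
    by apply: (mulfI c8); apply: etrans (etrans _ (congr2 +%R e1 e2)) _; ring.
  have f2 : k * (a + ac) = n * (A + A').
    by apply: (mulfI c6); apply: etrans (etrans _ (congr2 (fun x y => x - y) e1 e2)) _ => /=;
      ring.
  have f3 : k * (a - ac) = n * (A - A').
    have c6i : 6 * i != 0 by rewrite mulf_neq0.
    apply: (mulfI c6i).
    by apply: etrans (etrans _ (congr2 (fun x y => x - 8 * y) e3 f1)) _ => /=; ring.
  have c2 : 2 != 0 :> C by rewrite pnatr_eq0.
  split => //; split.
    by apply: (mulfI c2); apply: etrans (etrans _ (congr2 +%R f2 f3)) _; rewrite /A /A' /n; ring.
  by apply: (mulfI c2); apply: etrans (etrans _ (congr2 (fun x y => x - y) f2 f3)) _ => /=;
    rewrite /A /A' /n; ring.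
have [kB [ka kac]] := n0.
have k0 : k != 0.
  apply/eqP => k0; move/eqP: kB; rewrite k0 mul0r eq_sym.
  by rewrite mulf_eq0 expf_eq0 !mulf_eq0 conjC_eq0 (negPf l0) (negPf B'0).
have kb2 : k ^+ 2 * B ^+ 2 = B' ^+ 2 * (l * l^*) ^+ 4.
  by rewrite -exprMn kB exprMn -exprM.
have kaa : k ^+ 2 * (a * a^*) = a' * a'^* * (l * l^*) ^+ 4.
  apply: etrans (etrans _ (congr2 *%R ka kac)) _; first by ring.
  by move: (l^*) (a'^*) => lc ac'; ring.
have kk : k ^+ 2 != 0 by rewrite expf_eq0.
apply/eqP; rewrite eqr_div ?expf_neq0 //; apply/eqP; apply: (mulfI kk).
rewrite mulrA kaa [in RHS]mulrCA kb2.
by move: (l^*) (a'^*) => lc ac'; ring.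
Qed.

End Ratio.

(** * A point near which the multiplier is bounded *)

Section BaireCover.
Local Open Scope classical_set_scope.

(** A separate name keeps the complete normed structure declared below from
interfering with inference on other row vectors. *)
Definition chart_space (R : realType) : Type := 'rV[R]_6.
HB.instance Definition _ (R : realType) := NormedModule.copy (chart_space R) 'rV[R]_6.
HB.instance Definition _ (R : realType) := Complete.copy (chart_space R) 'rV[R]_6.

(** Baire's theorem for an open set covered by the relatively closed
complements of the sets A m. *)
Lemma baire_cover (R : realType) (U : completeNormedModType R) (B : set U) (A : nat -> set U) :
  open B -> B !=set0 ->
  (forall m u, B u -> A m u -> \forall v \near u, A m v) ->
  (forall u, B u -> exists m, ~ A m u) ->
  exists m u, B u /\ \forall v \near u, ~ A m v.
Proof.
move=> oB B0 oA nA; apply: contrapT => H.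
(* Adding the exterior of B turns density in B into density in the space. *)
pose O m := (B `&` A m) `|` ~` closure B.
have /Baire/(_ B B0 oB) : forall m, open (O m) /\ dense (O m).
  move=> m; split.
    apply: openU; last by apply: closed_openC; exact: closed_closure.
    rewrite openE => u [Bu Au]; apply: filterI; first exact: open_nbhs_nbhs.
    exact: oA.
  move=> W [w Ww] oW.
  have [[u [Wu Bu]]|WB] := pselect ((W `&` B) !=set0).
    apply: contrapT => WO; apply: H; exists m, u; split => //.
    have : \forall v \near u, W v /\ B v by apply: filterI; exact: open_nbhs_nbhs.
    apply: filterS => v [Wv Bv] Av; apply: WO; exists v; split => //.
    by left.
  exists w; split => //; right => clw; apply: WB.
  have [v [Bv Wv]] := clw W (open_nbhs_nbhs (conj oW Ww)).
  by exists v.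
move=> [u [Bu Ou]]; have [m nAm] := nA u Bu.
have [[_ //]|] := Ou m I.
by apply; exact: subset_closure.
Qed.

End BaireCover.

Section Chart.
Variable R : realType.
Local Notation C := (Cplx R).
Variables (a : C) (b : R).

(** The model is a graph over z and the real parts of the w_k. *)
Definition chart (u : 'rV[R]_6) : 'rV[C]_5 :=
  let z : C := (u 0 0)%:C + 'i * (u 0 (lift ord0 0))%:C in
  point_of z (fun k => (u 0 (lift ord0 (wcoord k)))%:C + 'i * hform (eqn_form a b k) z z^*).

Definition coords (q : 'rV[C]_5) : 'rV[R]_6 :=
  \row_j (if unlift ord0 j is Some i then
            if unlift ord0 i is Some k then complex.Re (q 0 (wcoord k)) else complex.Im (q 0 0)
          else complex.Re (q 0 0)).

Lemma hform_real (f : form R) (z : C) : formReal f -> (hform f z z^*)^* = hform f z z^*.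
Proof.
move=> [cr br]; rewrite /hform !(rmorphD, rmorphM, rmorphXn) /= !conjCK cr br.
by move: (z^*) => y; ring.
Qed.

Lemma chart_in u : CRmodel a b (chart u).
Proof.
apply/CRmodelP => k; rewrite /chart point_of_w point_of0.
set z : C := (u 0 0)%:C + 'i * _; have := hform_real z (eqn_form_real a b k); move: (hform _ _ _)
  => s sr.
by rewrite rmorphD rmorphM /= conj_real sr conjCi; ring.
Qed.

Lemma ReIm (z : C) : z = (complex.Re z)%:C + 'i * (complex.Im z)%:C.
Proof. by rewrite [LHS]complexE complexiE. Qed.

Lemma coordsK q : CRmodel a b q -> chart (coords q) = q.
Proof.
move=> /CRmodelP Mq.
have c0 : (coords q 0 0)%:C + 'i * (coords q 0 (lift ord0 0))%:C = q 0 0 :> C.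
  by rewrite !mxE unlift_none liftK unlift_none -ReIm.
apply: pointP; rewrite /chart; first by rewrite point_of0.
move=> k; rewrite point_of_w c0.
have -> : coords q 0 (lift ord0 (wcoord k)) = complex.Re (q 0 (wcoord k)).
  by rewrite mxE liftK /wcoord liftK.
have := Mq k; move: (hform _ _ _) (q 0 (wcoord k)) => s w h.
have c2i : 2 * 'i != 0 :> C by rewrite mulf_neq0 ?pnatr_eq0 ?neq0Ci.
have -> : s = (complex.Im w)%:C.
  apply: (mulfI c2i); rewrite -h {1 2}(ReIm w) rmorphD rmorphM /= !conj_real conjCi; ring.
by rewrite -ReIm.
Qed.

Lemma norm_Im (z : C) : `|complex.Im z|%:C <= `|z|.
Proof.
have := normc_ge_Re ('i%C * z : R[i]).
have -> : `|('i%C * z : R[i])| = `|z| by rewrite normrM complexiE normCi mul1r.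
by case: z => x y /=; rewrite mul0r mul1r sub0r normrN.
Qed.

Lemma coords_le (p q : 'rV[C]_5) (d : R) : `|q - p| < d%:C -> `|coords q - coords p| < d.
Proof.
move=> h; have d0 : 0 < d by rewrite -ltcR; apply: le_lt_trans h.
have hj j : `|q 0 j - p 0 j| < d%:C.
  by apply: le_lt_trans h; have := coord_le (q - p) j; rewrite !mxE.
have [->|/mx_norm_neq0[[i j] /= e]] := eqVneq `|coords q - coords p| 0; first by [].
rewrite [ltLHS]e ord1 {e} !mxE -ltcR.
case: unliftP => [i' _|_]; last first.
  by apply: le_lt_trans (hj 0); rewrite -raddfB normc_ge_Re.
case: unliftP => [k _|_].
  by apply: le_lt_trans (hj (wcoord k)); rewrite -raddfB normc_ge_Re.
by apply: le_lt_trans (hj 0); rewrite -raddfB norm_Im.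
Qed.

End Chart.

Section ContinuityAt.
Local Open Scope classical_set_scope.
Variable R : realType.
Local Notation C := (Cplx R).
Variables (X : topologicalType) (u : X).

Definition cont_at (W : topologicalType) (f : X -> W) := f @ u --> f u.

Lemma cont_at_row n (F : X -> 'rV[C]_n) : (forall j, cont_at (fun v => F v 0 j)) -> cont_at F.
Proof.
move=> h; apply/cvgrPdist_le => e e0.
have : \forall v \near u, forall j, `|F u 0 j - F v 0 j| <= e.
  apply: (@filter_forall X _ (fun j v => `|F u 0 j - F v 0 j| <= e) (nbhs u) _) => j.
  by have /cvgrPdist_le := h j; apply.
apply: filterS => v hv; apply: rV_norm_le => [|j]; first exact: ltW.
by rewrite !mxE; apply: hv.
Qed.
Lemma cont_at_cst (W : topologicalType) (c : W) : cont_at (fun _ => c).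
Proof. exact: cvg_cst. Qed.
Lemma cont_atD (W : normedModType C) (f g : X -> W) : cont_at f -> cont_at g -> cont_at (fun v =>
  f v + g v).
Proof. exact: cvgD. Qed.
Lemma cont_atB (W : normedModType C) (f g : X -> W) : cont_at f -> cont_at g -> cont_at (fun v =>
  f v - g v).
Proof. exact: cvgB. Qed.
Lemma cont_atZ (W : normedModType C) (c : C) (f : X -> W) : cont_at f -> cont_at (fun v => c *: f
  v).
Proof. exact: cvgZr. Qed.
Lemma cont_atM (f g : X -> C) : cont_at f -> cont_at g -> cont_at (fun v => f v * g v).
Proof. exact: cvgM. Qed.
Lemma cont_atX (f : X -> C) n : cont_at f -> cont_at (fun v => f v ^+ n).
Proof.
move=> cf; elim: n => [|n ih]; first exact: cont_at_cst.
rewrite (_ : (fun v => _) = (fun v => f v * f v ^+ n)); first exact: cont_atM.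
by apply/funext => v; rewrite exprS.
Qed.
Lemma cont_at_conj (f : X -> C) : cont_at f -> cont_at (fun v => (f v)^*).
Proof.
move=> cf; apply/cvgrPdist_le => e e0.
have /cvgrPdist_le/(_ e e0) := cf; apply: filterS => v.
by rewrite -rmorphB norm_conjC.
Qed.
Lemma cont_at_real (f : X -> R) : f @ u --> f u -> cont_at (fun v => (f v)%:C : C).
Proof.
move=> cf; apply/cvgrPdist_le => e /gt0_realC[r r0 ->].
have /cvgrPdist_le/(_ r r0) := cf; apply: filterS => v.
by rewrite -rmorphB norm_realC lecR.
Qed.
Lemma cont_at_coord n (F : X -> 'rV[C]_n) j : cont_at F -> cont_at (fun v => F v 0 j).
Proof.
move=> cf; apply/cvgrPdist_le => e e0.
have /cvgrPdist_le/(_ e e0) := cf; apply: filterS => v; apply: le_trans.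
by have := coord_le (F u - F v) j; rewrite !mxE.
Qed.
End ContinuityAt.

Ltac cont_at_tac := lazymatch goal with
  | |- cont_at _ (fun v => @?F v + @?G v) => apply: (@cont_atD _ _ _ _ F G); cont_at_tac
  | |- cont_at _ (fun v => @?F v * @?G v) => apply: (@cont_atM _ _ _ F G); cont_at_tac
  | |- cont_at _ (fun v => @?F v ^+ _) => apply: (@cont_atX _ _ _ F); cont_at_tac
  | |- cont_at _ (fun v => (@?F v)^*) => apply: (@cont_at_conj _ _ _ F); cont_at_tac
  | |- cont_at _ (fun v => ?c) => first [exact: cont_at_cst | assumption]
  | |- _ => assumption
  end.

Section BoundedMultiplier.
Local Open Scope classical_set_scope.
Variable R : realType.
Local Notation C := (Cplx R).
Variables (a a' : C) (b b' : R) (V : set 'rV[C]_5) (h : 'rV[C]_5 -> 'rV[C]_5).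
Hypotheses (oV : open V) (hV : forall x, V x -> differentiable h x).
Hypothesis hM : forall x, V x -> CRmodel a b x -> CRmodel a' b' (h x).

Lemma cont_at_hform (X : topologicalType) (u : X) (f : X -> C) F :
  cont_at u f -> cont_at u (fun v => hform F (f v) (f v)^*).
Proof. by move=> cf; rewrite /hform; cont_at_tac. Qed.

Lemma cont_at_contact (X : topologicalType) (u : X) (f : X -> C) F :
  cont_at u f -> cont_at u (fun v => contact F (f v) (f v)^*).
Proof. by move=> cf; rewrite /contact; cont_at_tac. Qed.

Lemma cont_at_chart (u : 'rV[R]_6) : cont_at u (chart a b).
Proof.
have cc j : cont_at u (fun v : 'rV[R]_6 => (v 0 j)%:C : C).
  by apply: cont_at_real; apply: coord_continuous.
apply: cont_at_row => j; rewrite /chart; under eq_fun do rewrite mxE.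
have cz := cont_atD (cc 0) (cont_atM (@cont_at_cst _ u C ('i : C)) (cc (lift ord0 0))).
have ck k := cont_atD (cc (lift ord0 (wcoord k))) (cont_atM (@cont_at_cst _ u C ('i : C))
  (@cont_at_hform _ u _ (eqn_form a b k) cz)).
by case: (unlift ord0 j) => [k|]; [exact: ck|exact: cz].
Qed.

Lemma cont_at_horiz (X : topologicalType) (u : X) (f : X -> C) : cont_at u f -> cont_at u (fun v
  => horiz a b (f v)).
Proof.
move=> cf; apply: cont_at_row => j; rewrite /horiz; under eq_fun do rewrite mxE.
by case: (unlift ord0 j) => [k|]; [exact: cont_at_contact|exact: cont_at_cst].
Qed.

Lemma cont_at_comp (X : topologicalType) (u : X) (f : X -> 'rV[C]_5) : cont_at u f -> V (f u) ->
  cont_at u (fun v => h (f v)).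
Proof.
move=> cf Vf; have /differentiable_continuous := hV Vf.
exact: cvg_comp.
Qed.

Lemma cont_at_near (X : topologicalType) (u : X) (f : X -> 'rV[C]_5) : cont_at u f -> V (f u) ->
  \forall v \near u, V (f v).
Proof. by move=> cf Vf; apply: cf; exact: open_nbhs_nbhs. Qed.

Let step (n : nat) : R := n.+1%:R^-1.
Let q1 n (u : 'rV[R]_6) := chart a b u + (step n)%:C *: horiz a b (chart a b u 0 0).
Let A (m : nat) : set 'rV[R]_6 := [set u | exists n, [/\ (m <= n)%N, V (q1 n u) &
  ~ `|h (q1 n u) 0 0 - h (chart a b u) 0 0| <= (m%:R * step n)%:C]].

Lemma chartK u : coords (chart a b u) = u.
Proof.
have re (x y : R) : complex.Re (x%:C + 'i * y%:C : C) = x.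
  by rewrite -complexiE /= !(mul0r, mulr0, subr0, subrr, addr0).
have im (x y : R) : complex.Im (x%:C + 'i * y%:C : C) = y.
  by rewrite -complexiE /= !(mul0r, mulr0, mul1r, add0r).
apply/rowP => j; rewrite mxE.
case: unliftP => [i ->|->]; last by rewrite point_of0 re.
case: unliftP => [k ->|->]; last by rewrite point_of0 im.
rewrite point_of_w; set z : C := (u 0 0)%:C + _.
have /CrealP/complex_realP[s ->] := hform_real z (eqn_form_real a b k).
by rewrite re.
Qed.

Lemma open_real_ball (W : normedModType C) (O : set W) (p : W) : open O -> O p ->
  exists2 r : R, 0 < r & forall q, `|q - p| < r%:C -> O q.
Proof.
move=> oO Op; have : nbhs p O by exact: open_nbhs_nbhs.
move=> /nbhs_ballP[r /= /gt0_realC[s s0 ->] hs]; exists s => // q hq.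
by apply: hs; rewrite -ball_normE /= distrC.
Qed.

Lemma norm_gt_open (X : topologicalType) (u : X) (f : X -> C) (M : R) : cont_at u f ->
  ~ `|f u| <= M%:C -> \forall v \near u, ~ `|f v| <= M%:C.
Proof.
move=> cf; have [r r0 e] := norm_real_ex (f u : C^o); rewrite e lecR => /negP; rewrite -ltNge =>
  Mr.
have d0 : 0 < (r - M)%:C :> C by rewrite ltcR subr_gt0.
have /cvgrPdist_lt/(_ _ d0) := cf; apply: filterS => v hv hf.
have : `|f u| < (r - M)%:C + M%:C.
  rewrite -[f u](subrK (f v)); apply: le_lt_trans (ler_normD _ _) _.
  exact: ltr_leD.
by rewrite e -rmorphD subrK ltxx.
Qed.

Lemma multiplier_scale (q : 'rV[C]_5) (t : C) :
  t * multiplier a b h q = ('d h q (t *: horiz a b (q 0 0))) 0 0.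
Proof. by rewrite linearZ mxE. Qed.

(** The multiplier at a point q of M is the limit of difference quotients
along q + step n horiz, which are continuous in q and bounded in n for each q.
Baire's theorem, applied in the chart, bounds them uniformly near some point
of M. *)
Lemma bounded_multiplier p0 : V p0 -> CRmodel a b p0 ->
  exists p rho Lam, [/\ V p /\ CRmodel a b p, 0 < rho, 0 <= Lam,
    (forall q : 'rV[C]_5, `|q - p| < rho%:C -> V q) &
    (forall q : 'rV[C]_5, `|q - p| < rho%:C -> CRmodel a b q -> `|multiplier a b h q| <= Lam%:C)].
Proof.
move=> V0 M0.
pose B := [set u | V (chart a b u)].
have oB : open B.
  by rewrite openE => u Bu; apply: cont_at_near Bu; exact: cont_at_chart.
have B0 : B !=set0 by exists (coords p0); rewrite /B /= coordsK.
have omp n : 0 < step n by rewrite invr_gt0.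
have [||m [u [Bu hu]]] := @baire_cover R (chart_space R) B A oB B0.
- move=> m u Bu [n [mn Vn hn]].
  have cP := @cont_at_chart u.
  have cL := @cont_at_horiz _ u _ (@cont_at_coord _ _ u _ _ 0 cP).
  have cq : cont_at u (q1 n) := @cont_atD _ _ u _ _ _ cP (@cont_atZ _ _ u _ (step n)%:C _ cL).
  have h1 := @cont_at_coord _ _ u _ _ 0 (@cont_at_comp _ u _ cq Vn).
  have h2 := @cont_at_coord _ _ u _ _ 0 (@cont_at_comp _ u _ cP Bu).
  have c1 : cont_at u (fun v => h (q1 n v) 0 0 - h (chart a b v) 0 0) := @cont_atB _ _ u _ _ _ h1
    h2.
  have := norm_gt_open c1 hn.
  have := cont_at_near cq Vn.
  by apply: filterS2 => v Vv hv; exists n.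
- move=> u Bu; have dh := hV Bu.
  have [D D0 hD] := diff_bounded dh.
  have [r r0 hr] := frechet dh ltr01.
  pose L := horiz a b (chart a b u 0 0).
  have [N N0 hN] := norm_real_ex L.
  pose x := N / r + (D + 1) * N.
  have x1 : 0 <= N / r by rewrite divr_ge0 // ltW.
  have x2 : 0 <= (D + 1) * N by rewrite mulr_ge0 // addr_ge0 // ltW.
  have xm := truncnS_gt x.
  exists (Num.truncn x).+1 => -[n [mn Vn hn]]; apply: hn.
  have xn : x < n.+1%:R by apply: lt_trans xm _; rewrite ltr_nat ltnS.
  have nL : `|(step n)%:C *: L| = (step n * N)%:C.
    by rewrite normrZ hN norm_realC gtr0_norm // rmorphM.
  have Lr : `|(step n)%:C *: L| < r%:C.
    rewrite nL ltcR /step mulrC ltr_pdivrMr // mulrC -ltr_pdivrMr //.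
    by apply: le_lt_trans xn; rewrite lerDl.
  have := hr _ Lr; rewrite mul1r -/(q1 n u) nL => h1.
  have -> : h (q1 n u) 0 0 - h (chart a b u) 0 0 =
    (h (q1 n u) - h (chart a b u) - 'd h (chart a b u) ((step n)%:C *: L)) 0 0
     + ('d h (chart a b u) ((step n)%:C *: L)) 0 0 by rewrite !mxE; ring.
  apply: le_trans (ler_normD _ _) _.
  apply: le_trans (lerD (le_trans (coord_le _ 0) h1) (le_trans (coord_le _ 0) (hD _))) _.
  rewrite nL -rmorphM -rmorphD lecR.
  have -> : step n * N + D * (step n * N) = (D + 1) * N * step n by ring.
  rewrite ler_wpM2r ?(ltW (omp n)) //.
  by apply: le_trans (ltW xm); rewrite lerDr.
have Vu : \forall v \near u, V (chart a b v) by apply: cont_at_near Bu; exact: cont_at_chart.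
have : \forall v \near u, V (chart a b v) /\ ~ A m v by exact: filterI.
move=> /nbhs_ballP[d /= d0 hd].
have [r1 r10 Vr] := open_real_ball oV (Bu : V (chart a b u)).
exists (chart a b u), (Num.min r1 d), (m%:R + 1); split.
- by split => //; exact: chart_in.
- by rewrite lt_min r10.
- by rewrite addr_ge0.
- by move=> q hq; apply: Vr; apply: lt_le_trans hq _; rewrite lecR ge_min lexx.
move=> q hq Mq; have hqr : `|q - chart a b u| < d%:C.
  by apply: lt_le_trans hq _; rewrite lecR ge_min lexx orbT.
have := coords_le hqr; rewrite chartK => hv.
have [] := hd (coords q).
  by rewrite -ball_normE /= distrC.
rewrite coordsK // => Vq nA.
have dh := hV Vq.
pose L := horiz a b (q 0 0).
have [N N0 hN] := norm_real_ex L.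
have N1 : 0 < N + 1 by rewrite ltr_wpDl.
have e0 : 0 < (N + 1)^-1 by rewrite invr_gt0.
have [r2 r20 hr2] := frechet dh e0.
have [r3 r30 hr3] := open_real_ball oV Vq.
pose r4 := Num.min r2 r3.
have r40 : 0 < r4 by rewrite lt_min r20.
pose n := maxn m (Num.truncn ((N + 1) / r4)).
have xn : (N + 1) / r4 < n.+1%:R.
  by apply: lt_le_trans (truncnS_gt _) _; rewrite ler_nat ltnS leq_maxr.
have nL : `|(step n)%:C *: L| = (step n * N)%:C.
  by rewrite normrZ hN norm_realC gtr0_norm // rmorphM.
have Lr : step n * N < r4.
  rewrite /step mulrC ltr_pdivrMr // mulrC -ltr_pdivrMr //.
  by apply: le_lt_trans xn; rewrite ler_pM2r ?invr_gt0 // lerDl.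
have Vn : V (q + (step n)%:C *: L).
  apply: hr3; rewrite addrAC subrr add0r nL ltcR.
  by apply: lt_le_trans Lr _; rewrite ge_min lexx orbT.
have := hr2 ((step n)%:C *: L); rewrite nL ltcR => /(_ (lt_le_trans Lr _)); rewrite ge_min lexx
  => /(_ isT) h1.
have h2 : `|h (q + (step n)%:C *: L) 0 0 - h q 0 0| <= (m%:R * step n)%:C.
  apply: contrapT => h2; apply: nA; exists n; rewrite /q1 coordsK //; split => //.
  exact: leq_maxl.
have oC : 0 < (step n)%:C :> C by rewrite ltcR.
rewrite -(ler_pM2l oC) -[X in X * `|_|](gtr0_norm oC) -normrM.
move: (multiplier_scale q (step n)%:C) h1; move: ('d _ _ _) => v elam h1.
have -> : (step n)%:C * multiplier a b h q = (h (q + (step n)%:C *: L) 0 0 - h q 0 0)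
   - (h (q + (step n)%:C *: L) - h q - v) 0 0 by rewrite elam !mxE; ring.
apply: le_trans (ler_normB _ _) _.
apply: le_trans (lerD h2 (le_trans (coord_le _ 0) h1)) _.
rewrite -!rmorphM -rmorphD lecR mulrDr mulr1 [step n * m%:R]mulrC lerD2l.
rewrite mulrCA ger_pMr // mulrC ler_pdivrMr // mul1r lerDl.
exact: ler01.
Qed.

End BoundedMultiplier.

(** * The two implications *)

Section Necessity.
Local Open Scope classical_set_scope.
Variable R : realType.
Local Notation C := (Cplx R).

(** Otherwise horiz would be in the kernel of the differential of h, although
h has a differentiable left inverse. *)
Lemma multiplier_neq0 (a a' : C) (b b' : R) (V : set 'rV[C]_5) (h g : 'rV[C]_5 -> 'rV[C]_5)
  (q : 'rV[C]_5) :
  open V -> (forall x, V x -> differentiable h x) ->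
  (forall x, V x -> CRmodel a b x -> CRmodel a' b' (h x)) ->
  (forall x, V x -> g (h x) = x) -> differentiable g (h q) ->
  V q -> CRmodel a b q -> multiplier a b h q != 0.
Proof.
move=> oV hV hM gh dg Vq Mq; apply/eqP => l0.
pose L := horiz a b (q 0 0).
have dL : 'd h q L = 0 by rewrite /L (tangency oV hV hM Vq Mq) l0 scale0r.
pose c (t : C) := q + t *: L.
have c0 : c 0 = q by rewrite /c scale0r addr0.
have dc : is_derive (0 : C) 1 c L.
  apply/is_derive_nearP => e e0; apply: filterE => x.
  by rewrite c0 add0r /c [q + _]addrC addrK subrr normr0 mulr_ge0 // ltW.
have Vc : V (c 0) by rewrite c0.
have dL0 : 'd h (c 0) L = 0 by rewrite c0.
have dh : is_derive (0 : C) 1 (h \o c) 0.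
  by rewrite -dL0; exact: is_derive_diff_comp dc (hV _ Vc).
have dg' : differentiable g ((h \o c) 0) by rewrite /= c0.
have dgh : is_derive (0 : C) 1 (g \o (h \o c)) 0.
  by have := is_derive_diff_comp dh dg'; rewrite (linear0 ('d g ((h \o c) 0))).
have dc' : is_derive (0 : C) 1 c 0.
  have /is_derive_nearP dn := dgh.
  apply/is_derive_nearP => e e0.
  have near := near_curve dc oV Vc.
  have := dn e e0; apply: filterS2 near => x Vx /=.
  by rewrite !gh.
have e1 : 'D_1 c 0 = L by case: dc.
have L0 : L = 0 by rewrite -e1; case: dc'.
have : L 0 0 = 0 by rewrite L0 mxE.
by rewrite /L /horiz point_of0 => /eqP; rewrite oner_eq0.
Qed.

Lemma equivalent_ratio (a a' : C) (b b' : R) : b != 0 -> b' != 0 ->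
  biholomorphically_equivalent (CRmodel a b) (CRmodel a' b') ->
  a * a^* / (b%:C : C) ^+ 2 = a' * a'^* / (b'%:C : C) ^+ 2.
Proof.
move=> b0 b'0 [p0 [p0' [V [V' [h [[Mp0 _] [[oV Vp0] [[oV' _] [[bh dh [g dg gh]] [_ im]]]]]]]]]].
have hM x : V x -> CRmodel a b x -> CRmodel a' b' (h x).
  move=> Vx Mx; have : (h @` (CRmodel a b `&` V)) (h x) by exists x.
  by rewrite im => -[].
have [p [rho [Lam [[Vp Mp] rho0 Lam0 Vr Lr]]]] := bounded_multiplier oV dh Vp0 Mp0.
have [k hk] := loop_identity oV dh hM Vp Mp rho0 Lam0 Vr Lr.
apply: ratio_of_loops b0 b'0 hk.
have V'h : V' (h p) by case: bh => fV _ _; apply: fV.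
exact: (multiplier_neq0 oV dh hM gh (dg _ V'h) Vp Mp).
Qed.

End Necessity.

Section Sufficiency.
Local Open Scope classical_set_scope.
Variable R : realType.
Local Notation C := (Cplx R).

(** For m = s + i t of modulus 1, multiplying z by m multiplies z^2 conj z by
m, so that (w_2, w_3), whose imaginary parts are twice its real and imaginary
parts, undergoes the rotation by m. *)
Definition twist (m s t c : C) (x : 'rV[C]_5) : 'rV[C]_5 :=
  point_of (m * x 0 0) (fun k => match val k with
    | 0%N => x 0 (wcoord 0)
    | 1%N => s * x 0 (wcoord 1) - t * x 0 (wcoord 2)
    | 2%N => t * x 0 (wcoord 1) + s * x 0 (wcoord 2)
    | _ => c * x 0 (wcoord 3) end).

Lemma twist_linear m s t c : linear (twist m s t c).
Proof.
move=> l x y; apply: pointP; rewrite /twist; first by rewrite [in RHS]mxE [in RHS]mxE !point_of0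
  !mxE; ring.
by move=> k; rewrite [in RHS]mxE [in RHS]mxE !point_of_w; case: (ord4P k) => -> /=; rewrite !mxE;
  ring.
Qed.

Lemma twist_continuous m s t c : continuous (twist m s t c).
Proof.
move=> x.
have cc j : cont_at x (fun v : 'rV[C]_5 => v 0 j) by exact: coord_continuous.
have cz (l : C) j := @cont_atM _ _ x _ _ (@cont_at_cst _ x C l) (cc j).
apply: cont_at_row => j; rewrite /twist; under eq_fun do rewrite mxE.
case: (unlift ord0 j) => [k|]; last exact: (cz m 0).
case: (ord4P k) => -> /=; [exact: (cc (wcoord 0)) | exact: (@cont_atB _ _ x _ _ _ (cz s (wcoord
  1)) (cz t (wcoord 2)))
 | exact: (@cont_atD _ _ x _ _ _ (cz t (wcoord 1)) (cz s (wcoord 2))) | exact: (cz c (wcoord 3))].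
Qed.

Lemma twist_differentiable m s t c x : differentiable (twist m s t c) x.
Proof.
pose rM := GRing.isLinear.Build _ _ _ _ _ (twist_linear m s t c).
pose rL : {linear 'rV[C]_5 -> 'rV[C]_5} := HB.pack (twist m s t c) rM.
rewrite (_ : twist m s t c = rL) //; apply: linear_differentiable; exact: twist_continuous.
Qed.

Lemma twistK m m' s t c c' x : m' * m = 1 -> s * s + t * t = 1 -> c' * c = 1 ->
  twist m' s (- t) c' (twist m s t c x) = x.
Proof.
move=> mm st cc; apply: pointP; rewrite /twist; first by rewrite !point_of0 mulrA mm mul1r.
move=> k; case: (ord4P k) => ->; rewrite !point_of_w //=.
- rewrite -[RHS]mul1r -st; ring.
- rewrite -[RHS]mul1r -st; ring.
- by rewrite mulrA cc mul1r.
Qed.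

Lemma twist_in (a a' m s t c : C) (b b' : R) x :
  m * m^* = 1 -> m = s + 'i * t -> s^* = s -> t^* = t -> c^* = c ->
  c * a = a' * m ^+ 2 -> c * b%:C = b'%:C ->
  CRmodel a b x -> CRmodel a' b' (twist m s t c x).
Proof.
move=> mm ms sr tr cr ca cb /CRmodelP Mx; apply/CRmodelP => k.
have i2 : 'i * 'i = -1 :> C by rewrite -expr2 sqrCi.
have conjNi : (- 'i)^* = 'i :> C by rewrite rmorphN /= conjCi opprK.
have mc : m^* = s - 'i * t by rewrite ms rmorphD rmorphM /= sr tr conjCi mulNr.
have cac : c * a^* = a'^* * m^* ^+ 2 by rewrite -{1}cr -rmorphM ca rmorphM rmorphXn.
have -> : twist m s t c x 0 0 = m * x 0 0 by rewrite /twist point_of0.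
rewrite rmorphM /=; have := Mx 0; have := Mx 1; have := Mx 2; have := Mx 3.
move: (x 0 0) (x 0 0)^* => z y M3 M2 M1 M0.
have red (A B D : C) : A - B = D -> A = D + B by move=> <-; rewrite subrK.
rewrite /hform /= conjNi ?conjC0 ?conjC1 in M0 M1 M2 M3.
rewrite /hform; case: (ord4P k) => ->; rewrite /twist point_of_w /= ?conjNi ?conjC0 ?conjC1.
- rewrite M0 (_ : 1 * (m * z) * (m^* * y) = m * m^* * (1 * z * y)); last by ring.
  by rewrite mm; ring.
- rewrite rmorphB !rmorphM /= sr tr.
  rewrite (_ : forall A B A' B' : C, s * A - t * B - (s * A' - t * B') = s * (A - A') - t * (B -
    B'));
    last by move=> *; ring.
  rewrite M1 M2 (_ : 1 * (m * z) ^+ 2 * (m^* * y) = m * m^* * (m * z ^+ 2 * y)); last by ring.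
  rewrite (_ : 1 * (m * z) * (m^* * y) ^+ 2 = m * m^* * (m^* * z * y ^+ 2)); last by ring.
  by rewrite mm mc ms; ring.
- rewrite rmorphD !rmorphM /= sr tr.
  rewrite (_ : forall A B A' B' : C, t * A + s * B - (t * A' + s * B') = t * (A - A') + s * (B -
    B'));
    last by move=> *; ring.
  rewrite M1 M2 (_ : - 'i * (m * z) ^+ 2 * (m^* * y) = m * m^* * (- 'i * (m * z ^+ 2 * y))); last
    by ring.
  rewrite (_ : 'i * (m * z) * (m^* * y) ^+ 2 = m * m^* * ('i * (m^* * z * y ^+ 2))); last by ring.
  rewrite mm mc ms.
  have -> : t * (2 * 'i * (0 * z * y + 1 * z ^+ 2 * y + 1 * z * y ^+ 2 + 0 * z ^+ 3 * y + 0 * z *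
    y ^+ 3
     + 0 * z ^+ 2 * y ^+ 2)) = - ('i * 'i) * (2 * 'i * t * (z ^+ 2 * y + z * y ^+ 2)).
    by rewrite i2; ring.
  ring.
- rewrite rmorphM /= cr -mulrBr M3.
  rewrite (_ : a' * (m * z) ^+ 3 * (m^* * y) = m * m^* * (a' * m ^+ 2 * (z ^+ 3 * y))); last by
    ring.
  rewrite (_ : a'^* * (m * z) * (m^* * y) ^+ 3 = m * m^* * (a'^* * m^* ^+ 2 * (z * y ^+ 3)));
    last first.
    by move: (a'^*) => u; ring.
  rewrite (_ : b'%:C * (m * z) ^+ 2 * (m^* * y) ^+ 2 = (m * m^*) ^+ 2 * (b'%:C * (z ^+ 2 * y ^+
    2)));
    last by ring.
  rewrite mm -ca -cac -cb; move: (a^*) => u; ring.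
Qed.

(** The rotation is by a square root of c a / a', where c = b' / b; this
number has modulus 1 because the ratios agree. *)
Lemma ratio_equivalent (a a' : C) (b b' : R) : a != 0 -> a' != 0 -> b != 0 -> b' != 0 ->
  a * a^* / (b%:C : C) ^+ 2 = a' * a'^* / (b'%:C : C) ^+ 2 ->
  biholomorphically_equivalent (CRmodel a b) (CRmodel a' b').
Proof.
move=> a0 a'0 b0 b'0 e.
have bC (x : R) : x != 0 -> x%:C != 0 :> C.
  by rewrite -(rmorph0 (real_complex R)) (inj_eq (@complexI R)).
pose c : C := b'%:C / b%:C.
have cr : c^* = c by rewrite /c rmorphM fmorphV /= !conj_real.
have c0 : c != 0 by rewrite mulf_neq0 ?invr_eq0 ?bC.
have cb : c * b%:C = b'%:C by rewrite /c divfK ?bC.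
have cE : c = b'%:C / b%:C by [].
clearbody c; pose m := sqrtC (c * a / a').
have m2 : m ^+ 2 = c * a / a' by exact: sqrtCK.
have ca : c * a = a' * m ^+ 2 by rewrite m2 [RHS]mulrC divfK.
have ac0 : a^* != 0 by rewrite conjC_eq0.
have ac'0 : a'^* != 0 by rewrite conjC_eq0.
have mm : m * m^* = 1.
  have h : (m * m^*) ^+ 2 = 1 ^+ 2.
    rewrite exprMn -rmorphXn m2 !rmorphM fmorphV /= cr expr1n.
    have e' : c ^+ 2 * (a * a^*) = a' * a'^*.
      apply: (mulIf (_ : (b'%:C ^+ 2)^-1 != 0)); first by rewrite invr_eq0 expf_eq0 bC.
      rewrite -e cE; move: (a^*) => u; field.
      by rewrite !bC.
    move: e' ac'0; move: (a^*) (a'^*) => u v e' v0.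
    rewrite (_ : c * a / a' * (c * u / v) = c ^+ 2 * (a * u) / (a' * v)); last by field; rewrite
      a'0 v0.
    by rewrite e' divff // mulf_neq0.
  by apply/eqP; rewrite -(eqrXn2 (n := 2)) ?mul_conjC_ge0 ?ler01 //; apply/eqP.
pose s : C := (complex.Re m)%:C; pose t : C := (complex.Im m)%:C.
have sr : s^* = s by exact: conj_real.
have tr : t^* = t by exact: conj_real.
have ms : m = s + 'i * t by exact: ReIm.
have mc : m^* = s + 'i * (- t) by rewrite ms rmorphD rmorphM /= sr tr conjCi; ring.
have i2 : 'i * 'i = -1 :> C by rewrite -expr2 sqrCi.
have st : s * s + t * t = 1.
  by rewrite -mm mc {1}ms -[t * t]opprK -[X in _ - X]mulN1r -i2; ring.
have mm' : m^* * m = 1 by rewrite mulrC.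
have st' : s * s + - t * - t = 1 by rewrite mulrNN.
pose h := twist m s t c; pose g := twist m^* s (- t) c^-1.
have gh : cancel h g by move=> x; apply: twistK => //; rewrite mulVf.
have hg : cancel g h by move=> x; have := twistK x mm st' (mulfV c0); rewrite opprK.
have hin x : CRmodel a b x -> CRmodel a' b' (h x) by exact: twist_in.
have gin x : CRmodel a' b' x -> CRmodel a b (g x).
  apply: twist_in => //.
  - by rewrite conjCK.
  - by rewrite rmorphN /= tr.
  - by rewrite fmorphV /= cr.
  - apply: (mulfI c0); rewrite mulVKf // [in RHS]mulrA ca -mulrA -exprMn mm expr1n mulr1.
    by [].
  - by apply: (mulfI c0); rewrite mulVKf // cb.
have M0 (a1 : C) (b1 : R) : CRmodel a1 b1 0.
  by apply/CRmodelP => k; rewrite !mxE conjC0 /hform; ring.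
have h0 : h 0 = 0.
  apply: pointP => [|k]; rewrite [in RHS]mxE /h /twist ?point_of0 ?point_of_w; first by rewrite
    mxE mulr0.
  by case: (ord4P k) => -> /=; rewrite !mxE; ring.
exists 0, 0, setT, setT, h; split; first by split; exact: M0.
split; first by split => //; exact: openT.
split; first by split => //; exact: openT.
split; last first.
  split => //; apply/seteqP; split => [y [x [Mx _] <-]|y [My _]]; first by split => //; exact:
    hin.
  by exists (g y); [split => //; exact: gin|exact: hg].
split.
- split => //; first by move=> x y _ _ /(congr1 g); rewrite !gh.
  by move=> y _; exists (g y).
- by move=> x _; exact: twist_differentiable.
- by exists g => [x _|x _]; [exact: twist_differentiable|exact: gh].
Qed.

End Sufficiency.

Unset Implicit Arguments.

Theorem theorem3p1 (R : realType) (a a' : Cplx R) (b b' : R)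
    (ha : a != 0) (ha' : a' != 0) (hb : b != 0) (hb' : b' != 0) :
  biholomorphically_equivalent (CRmodel a b) (CRmodel a' b') <->
  a * a^* / (b%:C : Cplx R) ^+ 2 = a' * a'^* / (b'%:C : Cplx R) ^+ 2.
Proof.
split; first exact: equivalent_ratio.
exact: ratio_equivalent.
Qed.
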